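(* There is an algorithm which, given a graph $G$ with $n$ vertices and $m$ edges and $\operatorname{pg}(G)=\gamma$, the integer $\gamma$, and a vertex $s$, computes a shortest path starting in $s$ whose eccentricity is minimal among all shortest paths starting in $s$. It runs in $\mathcal{O}(n^{\gamma+3})$ time if $\gamma\ge 2$, in $\mathcal{O}(n^2m)$ time if $\gamma=1$, and in $\mathcal{O}(nm)$ time if $\gamma=0$.
   Context: Graphs are finite, connected, unweighted, undirected and simple. $d_G$ denotes shortest-path distance, $d_G(v,S)=\min_{u\in S}d_G(u,v)$, $\operatorname{ecc}(S)=\max_{u\in V}d_G(u,S)$. For a vertex $x$ and a set $S$, the projection is $\Pr(x,S)=\{u\in S\mid d_G(u,x)=d_G(x,S)\}$. Projection gap: for an integer $\gamma\ge 0$, say $G$ has projection gap at most $\gamma$ if for every shortest path $P=(v_0,\dots,v_l)$ (with $d_G(v_0,v_i)=i$), every vertex $x$ of $G$ and every two vertices $v_i,v_k\in\Pr(x,P)$ with $i<k$, $d_G(v_i,v_k)>\gamma+1$ implies that there is a vertex $v_j\in\Pr(x,P)$ with $i<j<k$; $\operatorname{pg}(G)$ is the least such $\gamma$. *)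

(* Defs.v *)
From mathcomp Require Import all_boot.

Set Implicit Arguments.
Unset Strict Implicit.
Unset Printing Implicit Defensive.

(** * Graphs, shortest paths and projection gap *)

Definition connected_simple_graph (T : finType) (e : rel T) : Prop :=
  [/\ symmetric e, irreflexive e & forall x y : T, connect e x y].

Definition edges (T : finType) (e : rel T) : {set {set T}} :=
  [set [set xy.1; xy.2] | xy : T * T & e xy.1 xy.2].

Definition has_walk (T : finType) (e : rel T) (x y : T) (k : nat) : bool :=
  [exists p : k.-tuple T, path e x p && (last x p == y)].

(** The least length of a walk from [x] to [y].  Lengths below [#|T|] suffice,
    and the value is [#|T|] when [y] is unreachable from [x]. *)
Definition dist (T : finType) (e : rel T) (x y : T) : nat :=
  find (has_walk e x y) (iota 0 #|T|).

(** [#|T|] is an upper bound of [dist]; it is only the value when [S] is empty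
    or unreachable. *)
Definition dist_set (T : finType) (e : rel T) (v : T) (S : {set T}) : nat :=
  \big[minn/#|T|]_(u in S) dist e u v.

Definition ecc (T : finType) (e : rel T) (S : {set T}) : nat :=
  \max_(u : T) dist_set e u S.

Definition Pr (T : finType) (e : rel T) (x : T) (S : {set T}) : {set T} :=
  [set u in S | dist e u x == dist_set e x S].

(** As in [path], the path with first vertex [v0] and remaining vertices [p]
    has [size p] edges. *)
Definition shortest_path (T : finType) (e : rel T) (v0 : T) (p : seq T) : bool :=
  path e v0 p && (dist e v0 (last v0 p) == size p).

Definition pg_at_most (T : finType) (e : rel T) (gamma : nat) : Prop :=
  forall (v0 : T) (p : seq T), shortest_path e v0 p ->
  let P := v0 :: p in
  let v i := nth v0 P i in
  forall (x : T) (i k : nat),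
    i < k < size P ->
    v i \in Pr e x [set w in P] -> v k \in Pr e x [set w in P] ->
    gamma + 1 < dist e (v i) (v k) ->
    exists j, i < j < k /\ v j \in Pr e x [set w in P].

Definition is_pg (T : finType) (e : rel T) (gamma : nat) : Prop :=
  pg_at_most e gamma /\ (forall g, pg_at_most e g -> gamma <= g).

(** * A word RAM

    Structured programs over scalar registers and arrays, both indexed by [nat].
    A fixed program mentions finitely many of them, so this is a random access
    machine up to a constant factor in time.  Words are the naturals below [W]:
    a computation that produces a larger value is stuck.  This keeps the
    unit-cost arithmetic honest, since long integers cannot be packed into one
    word. *)

Inductive binop := Add | Sub | Mul | Div | Mod | Lt | Eq.

Inductive expr :=
  | Cst of nat
  | Var of nat
  | Get of nat & expr
  | Op of binop & expr & expr.

Inductive cmd :=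
  | Skip
  | Assign of nat & expr
  | Put of nat & expr & expr
  | Seq of cmd & cmd
  | If of expr & cmd & cmd
  | While of expr & cmd.

Record state := State { reg : nat -> nat; arr : nat -> nat -> nat }.

Definition set_reg (st : state) (x v : nat) : state :=
  State (fun y => if y == x then v else reg st y) (arr st).

Definition set_arr (st : state) (a i v : nat) : state :=
  State (reg st)
    (fun b j => if (b == a) && (j == i) then v else arr st b j).

Definition word (W v : nat) : option nat := if v < W then Some v else None.

(** [Sub] is truncated, [Div] and [Mod] by zero follow [divn] and [modn]. *)
Definition binop_sem (o : binop) (a b : nat) : nat :=
  match o with
  | Add => a + b
  | Sub => a - b
  | Mul => a * b
  | Div => a %/ b
  | Mod => a %% b
  | Lt => (a < b : nat)
  | Eq => (a == b : nat)
  end.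

Fixpoint eval (W : nat) (st : state) (e : expr) : option nat :=
  match e with
  | Cst c => word W c
  | Var x => word W (reg st x)
  | Get a e1 => obind (fun i => word W (arr st a i)) (eval W st e1)
  | Op o e1 e2 =>
      obind (fun v1 => obind (fun v2 => word W (binop_sem o v1 v2))
                             (eval W st e2))
            (eval W st e1)
  end.

Fixpoint cost (e : expr) : nat :=
  match e with
  | Cst _ | Var _ => 1
  | Get _ e1 => (cost e1).+1
  | Op _ e1 e2 => (cost e1 + cost e2).+1
  end.

(** [exec W c st t st'] : run from [st], [c] halts in [st'] after [t] steps. *)
Inductive exec (W : nat) : cmd -> state -> nat -> state -> Prop :=
  | ExecSkip st : exec W Skip st 1 st
  | ExecAssign st x e v :
      eval W st e = Some v ->
      exec W (Assign x e) st (cost e).+1 (set_reg st x v)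
  | ExecPut st a e1 e2 i v :
      eval W st e1 = Some i -> eval W st e2 = Some v ->
      exec W (Put a e1 e2) st (cost e1 + cost e2).+1 (set_arr st a i v)
  | ExecSeq st st1 st2 c1 c2 t1 t2 :
      exec W c1 st t1 st1 -> exec W c2 st1 t2 st2 ->
      exec W (Seq c1 c2) st (t1 + t2) st2
  | ExecIf st st' e v c1 c2 t :
      eval W st e = Some v ->
      exec W (if v != 0 then c1 else c2) st t st' ->
      exec W (If e c1 c2) st (cost e + t).+1 st'
  | ExecWhileFalse st e c :
      eval W st e = Some 0 ->
      exec W (While e c) st (cost e).+1 st
  | ExecWhileTrue st st1 st2 e v c t1 t2 :
      eval W st e = Some v -> v != 0 ->
      exec W c st t1 st1 -> exec W (While e c) st1 t2 st2 ->
      exec W (While e c) st (cost e + t1 + t2).+1 st2.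

(** * Input and output conventions *)

(** Each list enumerates a neighbourhood without repetition, in any order. *)
Definition adjacency_lists (n : nat) (e : rel 'I_n)
    (adj : 'I_n -> seq 'I_n) : Prop :=
  forall u, uniq (adj u) /\ adj u =i e u.

(** Registers 0, 1, 2 hold [n], [gamma] and [s].  Array 1 is the concatenation
    of the adjacency lists; that of [u] occupies the cells from entry [u]
    (included) to entry [u + 1] (excluded) of array 0.  Every other register or
    cell is 0. *)
Definition input (n : nat) (adj : 'I_n -> seq 'I_n) (gamma : nat) (s : 'I_n)
    : state :=
  let lists := [seq adj u | u <- enum 'I_n] in
  let offsets := mkseq (fun i => sumn (take i (shape lists))) n.+1 in
  let nbrs := [seq val w | w <- flatten lists] in
  State (nth 0 [:: n; gamma; val s])
        (fun a => nth 0 (nth [::] [:: offsets; nbrs] a)).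

(** The length of the output is left in register 0, its entries in array 0. *)
Definition output (st : state) : seq nat := mkseq (arr st 0) (reg st 0).

(* Main.v *)
(** Along a shortest path the vertices at distance at most [K] from a fixed
    vertex [x] leave gaps of length at most [gamma + 1].  Hence, if [x] has a
    closer vertex beyond a window of [gamma + 1] consecutive path vertices than
    in the window, no earlier path vertex is closer than the window.  The
    distance from [x] to the whole path can thus be read off the window and the
    next vertex, at the step from where something closer lies ahead to where it
    does not.  So the eccentricity of a maximal shortest path from [s] is the
    maximum of charges which depend only on a window and its successor vertex,
    and a backward dynamic program over windows minimises it.  There are at most
    [n ^ gamma * 2 m] pairs of a window and a successor vertex, and a charge
    takes time [n].  The distances come from one breadth-first search over pairs
    of vertices. *)

Require Import Defs.
From mathcomp Require Import all_boot zify.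

Set Implicit Arguments.
Unset Strict Implicit.
Unset Printing Implicit Defensive.

(** The obstacle is that the vertex of a path nearest to [x] may lie anywhere on it, so the
    eccentricity is not visibly a maximum of local terms. A window of [gamma + 1] positions is just
    long enough: two positions on both sides of it are more than [gamma + 1] apart, wider than any
    gap of a sublevel set. To use this while the rest of the path is still open, the known part is
    continued by a shortest walk to a closer descendant, whatever continuation is chosen in the end.
    A charge made along a path is the exact distance of its [x] to that path, so the maximum needs
    no record of which [x] are already settled. Every [x] other than [s] is charged if the path is
    maximal, and restricting to maximal paths loses nothing because prolonging a path never raises
    its eccentricity. Windows are coded as numbers with [gamma + 1] digits in base [n]. The
    recursion is solved for every code, even one that is no window of a path; correctness only
    follows codes of shortest paths. Successors lie farther from [s], so codes are treated by
    decreasing distance of their last vertex from [s]. *)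

Section BigMin.
Variables (I : finType) (P : pred I) (F : I -> nat) (b : nat).

Lemma bigmin_leq_cond i : P i -> \big[minn/b]_(j | P j) F j <= F i.
Proof.
move=> Pi; have : i \in index_enum I by rewrite mem_index_enum.
elim: (index_enum I) => // j r IH; rewrite inE big_cons => /orP[/eqP <-|/IH].
  by rewrite Pi geq_minl.
by case: ifP => // _ H; rewrite geq_min H orbT.
Qed.

Lemma leq_bigmin m :
  m <= b -> (forall i, P i -> m <= F i) -> m <= \big[minn/b]_(j | P j) F j.
Proof.
move=> mb mF; apply: (big_ind (fun k => m <= k)) => // x y mx my.
by rewrite leq_min mx.
Qed.

(** The default [b] takes part in the minimum. It is excluded later by exhibiting a term strictly
    below [b]. *)
Lemma bigmin_attained :
  \big[minn/b]_(j | P j) F j = b \/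
  exists2 i, P i & \big[minn/b]_(j | P j) F j = F i.
Proof.
apply: (big_ind (fun k => k = b \/ exists2 i, P i & k = F i)); [by left| |].
- move=> x y Hx Hy; rewrite /minn; by case: ifP.
- by move=> i Pi; right; exists i.
Qed.

End BigMin.

(** * Shortest-path distances in a finite connected graph *)

Section Distance.
Variables (T : finType) (e : rel T).
Hypothesis graph_e : connected_simple_graph e.

Local Notation d := (dist e).

Lemma has_walkP x y k :
  reflect (exists p, [/\ path e x p, last x p = y & size p = k])
          (has_walk e x y k).
Proof.
apply: (iffP existsP) => [[p /andP[pp /eqP lp]]|[p [pp lp sp]]].
  by exists p; rewrite size_tuple.
have sp' : size p == k by apply/eqP.
by exists (Tuple sp'); rewrite /= pp lp eqxx.
Qed.

Lemma dist_walk x p : path e x p -> d x (last x p) <= size p.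
Proof.
move=> pp; rewrite leqNgt; apply/negP => lt_d.
have ltT : size p < #|T|.
  by apply: leq_trans lt_d _; rewrite -[leqRHS](size_iota 0) find_size.
have := before_find 0 lt_d; rewrite nth_iota // add0n => /has_walkP[].
by exists p.
Qed.

(** A walk without repeated vertices has fewer than [#|T|] edges. So the default [#|T|] of the
    minima over vertices is larger than every distance. *)
Lemma dist_ltn_card x y : d x y < #|T|.
Proof.
case: graph_e => _ _ /(_ x y) /connectP[p pp ->].
case: (shortenP pp) => p' pp' Up' _ .
apply: leq_ltn_trans (dist_walk pp') _.
by rewrite -ltnS -[(size p').+1]/(size (x :: p')) ltnS -(card_uniqP Up') max_card.
Qed.

Lemma shortest_walk x y :
  exists p, [/\ path e x p, last x p = y & size p = d x y].
Proof.
apply/has_walkP; have := dist_ltn_card x y; rewrite /dist => lt_d.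
have := lt_d; rewrite -{2}(size_iota 0 #|T|) -has_find => /(nth_find 0).
by rewrite nth_iota.
Qed.

Lemma distxx x : d x x = 0.
Proof. by apply/eqP; rewrite -leqn0 (@dist_walk x [::]). Qed.

Lemma dist_eq0 x y : d x y = 0 -> x = y.
Proof. by case: (shortest_walk x y) => [[|? ?]] [_ <- <-]. Qed.

Lemma dist_triangle y x z : d x z <= d x y + d y z.
Proof.
case: (shortest_walk x y) => p [pp lp <-].
case: (shortest_walk y z) => q [pq lq <-].
rewrite -size_cat -lq -lp -last_cat; apply: dist_walk.
by rewrite cat_path pp lp.
Qed.

Lemma dist_edge x y : e x y -> d x y <= 1.
Proof. by move=> xy; apply: (@dist_walk x [:: y]); rewrite /= xy. Qed.

Lemma distC x y : d x y = d y x.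
Proof.
have sub u v : d u v <= d v u.
  case: (shortest_walk v u) => p [pp lp <-].
  have := dist_walk (x := last v p) (p := rev (belast v p)).
  have -> : last (last v p) (rev (belast v p)) = v.
    by case: p {pp lp} => //= z p; rewrite rev_cons last_rcons.
  rewrite lp size_rev size_belast -lp; apply.
  rewrite rev_path; apply: sub_path pp => a b; case: graph_e => e_sym _ _.
  by rewrite /= e_sym.
by apply/eqP; rewrite eqn_leq !sub.
Qed.

Lemma dist_pred x y k : d x y = k.+1 -> exists2 z, e z y & d x z = k.
Proof.
case: (shortest_walk x y) => p [pp lp sp] dk; move: lp pp; rewrite -sp in dk.
case/lastP: p sp dk => // p z sp; rewrite size_rcons last_rcons => -[spk] zy.
rewrite rcons_path => /andP[pp ez]; exists (last x p); first by rewrite -zy.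
have := dist_walk pp; have := dist_triangle (last x p) x y.
have : d (last x p) y <= 1 by apply: dist_edge; rewrite -zy.
by rewrite size_rcons in sp; lia.
Qed.

Lemma dist_succ x y k : d x y = k.+1 -> exists2 z, e x z & d z y = k.
Proof.
rewrite distC => /dist_pred[z ezx dz]; exists z; last by rewrite distC.
by case: graph_e => -> _ _.
Qed.

(** * Positions along a shortest path *)

Section ShortestPath.
Variables (x0 : T) (p : seq T).
Hypothesis sp : shortest_path e x0 p.
Local Notation v := (nth x0 (x0 :: p)).

Lemma shortest_path_edge i : i < size p -> e (v i) (v i.+1).
Proof. by move=> ip; case/andP: sp => /pathP - /(_ x0 i ip). Qed.

(** Each of the three pieces cut off at [i] and [j] bounds the distance of its ends from above by
    its number of edges. Together they attain the distance of the ends of the path, so every bound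
    is tight. *)
Lemma dist_shortest_path i j : i <= j -> j <= size p -> d (v i) (v j) = j - i.
Proof.
have upper a k : a + k <= size p -> d (v a) (v (a + k)) <= k.
  elim: k => [|k IH] ak; first by rewrite addn0 distxx.
  have := dist_triangle (v (a + k)) (v a) (v (a + k.+1)).
  have : d (v (a + k)) (v (a + k.+1)) <= 1.
    by rewrite addnS; apply: dist_edge; apply: shortest_path_edge; lia.
  by have := IH ltac:(lia); lia.
move=> ij jp; have := upper 0 i ltac:(lia); have := upper i (j - i) ltac:(lia).
have := upper j (size p - j) ltac:(lia).
rewrite add0n subnKC // subnKC // => u1 u2 u3.
case/andP: (sp) => _ /eqP; rewrite (last_nth x0) => dl.
have := dist_triangle (v i) (v 0) (v (size p)).
have := dist_triangle (v j) (v i) (v (size p)).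
by rewrite dl; lia.
Qed.

Lemma nth_subpath i k j : i <= k -> k <= size p -> j <= k - i ->
  nth (v i) (v i :: take (k - i) (drop i p)) j = v (i + j).
Proof.
move=> ik kp; case: j => [|j] jk; first by rewrite addn0.
rewrite /= nth_take // nth_drop addnS /=.
by apply: set_nth_default; lia.
Qed.

Lemma shortest_subpath i k : i <= k -> k <= size p ->
  shortest_path e (v i) (take (k - i) (drop i p)).
Proof.
move=> ik kp.
have sz : size (take (k - i) (drop i p)) = k - i.
  by rewrite size_takel // size_drop; lia.
have vsub j : j <= k - i ->
    nth (v i) (v i :: take (k - i) (drop i p)) j = v (i + j).
  exact: nth_subpath.
apply/andP; split; last first.
  by rewrite (last_nth (v i)) sz vsub // subnKC // dist_shortest_path.
apply/(pathP (v i)) => j; rewrite sz => jk.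
have := vsub j.+1 jk; rewrite /= => ->.
by rewrite vsub ?addnS; [apply: shortest_path_edge; lia|lia].
Qed.

(* A sublevel set of the distance to [x] along a shortest path has gaps of
   length at most [gamma + 1]: two consecutive elements of it are the whole
   projection of [x] on the subpath which they bound. *)
Lemma sublevel_gap gamma x K i k :
  pg_at_most e gamma -> i < k -> k <= size p ->
  d (v i) x <= K -> d (v k) x <= K ->
  (forall j, i < j < k -> K < d (v j) x) -> k <= i + gamma.+1.
Proof.
move=> pg ik kp di dk dj; rewrite leqNgt; apply/negP => gap.
have diS : K < d (v i.+1) x by apply: dj; lia.
have dkP : K < d (v k.-1) x by apply: dj; lia.
(* One edge changes the distance to [x] by at most 1, and the inner neighbours of both ends are
   beyond [K]; hence both ends are at distance exactly [K]. *)
have diK : d (v i) x = K.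
  have := dist_triangle (v i) (v i.+1) x; rewrite (distC (v i.+1) (v i)).
  by rewrite (@dist_shortest_path i i.+1); lia.
have dkK : d (v k) x = K.
  have := dist_triangle (v k) (v k.-1) x.
  by rewrite (@dist_shortest_path k.-1 k); lia.
set q := take (k - i) (drop i p).
have sq : size q = k - i by rewrite size_takel // size_drop; lia.
have vq j : j <= k - i -> nth (v i) (v i :: q) j = v (i + j).
  by apply: nth_subpath; lia.
have qmem j : j <= k - i -> v (i + j) \in v i :: q.
  by move=> jk; rewrite -vq //; apply: mem_nth; rewrite /= sq; lia.
have dS : dist_set e x [set w in v i :: q] = K.
  apply/eqP; rewrite eqn_leq; apply/andP; split.
    rewrite -[leqRHS]diK; apply: bigmin_leq_cond; rewrite inE.
    by have := qmem 0; rewrite addn0; apply.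
  apply: leq_bigmin; first by rewrite -diK ltnW // dist_ltn_card.
  move=> w; rewrite inE => /(nthP (v i))[j]; rewrite /= sq => jk <-.
  rewrite vq; last by lia.
  have [->|j0] := eqVneq j 0; first by rewrite addn0 diK.
  have [->|jki] := eqVneq j (k - i); first by rewrite subnKC ?dkK; lia.
  by apply: ltnW; apply: dj; lia.
have := pg _ _ (shortest_subpath (ltnW ik) kp) x 0 (k - i).
rewrite -/q [size _]/= sq => /(_ ltac:(lia)).
rewrite !vq // ?addn0 ?subnKC; try lia.
rewrite !inE dS dkK diK !eqxx /=.
have := qmem (k - i); rewrite subnKC ?inE; last by lia.
move=> ->; rewrite // dist_shortest_path; try lia.
move=> /(_ isT isT ltac:(lia))[j [jk]].
rewrite !inE vq; last by lia.
case/andP => _ /eqP; have := dj (i + j) ltac:(lia); rewrite /dist_set in dS *.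
by rewrite dS; lia.
Qed.

End ShortestPath.

(** * Charging eccentricity to windows *)

Section Window.
Variables (s : T) (gamma : nat).
Hypothesis pg : pg_at_most e gamma.

(** Equivalently, [u] lies on some shortest path from [s] to [y]: these are the vertices that a
    shortest path ending in [u] can still reach. *)
Definition descendant (u y : T) : bool := d s y == d s u + d u y.

Definition dist_desc (u x : T) : nat :=
  \big[minn/#|T|]_(y | descendant u y) d y x.

Definition child (u v : T) : bool := e u v && (d s v == (d s u).+1).

(** [a] stands for the distance from [x] to the window that ends in [u]. The value 0 is neutral for
    the maximum over [x]. *)
Definition charge_at (a : nat) (u v x : T) : nat :=
  let b := minn a (d v x) in
  if (dist_desc u x < a) && (b <= dist_desc v x) then b else 0.

Lemma descendantxx u : descendant u u.
Proof. by rewrite /descendant distxx addn0. Qed.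

Lemma descendant_child u v y : child u v -> descendant v y -> descendant u y.
Proof.
rewrite /descendant => /andP[euv /eqP dv] /eqP dy; apply/eqP.
have := dist_triangle u s y; have := dist_triangle v u y.
by have := dist_edge euv; lia.
Qed.

(** The first step of a shortest walk from [u] to [y]. Together with [descendant_child] it gives the
    recursion by which [dist_desc] is computed. *)
Lemma descendant_split u y :
  descendant u y -> y = u \/ exists2 v, child u v & descendant v y.
Proof.
move=> /eqP duy; case dk: (d u y) => [|k]; first by left; rewrite (dist_eq0 dk).
right; have [v euv dv] := dist_succ dk; exists v.
  rewrite /child euv; apply/eqP.
  have := dist_triangle u s v; have := dist_triangle v s y.
  by have := dist_edge euv; lia.
apply/eqP; have := dist_triangle u s v; have := dist_triangle v s y.
by have := dist_edge euv; lia.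
Qed.

Lemma dist_desc_leq u x y : descendant u y -> dist_desc u x <= d y x.
Proof. exact: bigmin_leq_cond. Qed.

Lemma dist_descE u x : exists2 y, descendant u y & dist_desc u x = d y x.
Proof.
case: (bigmin_attained (descendant u) (fun y => d y x) #|T|) => // dT.
have := dist_desc_leq x (descendantxx u); rewrite {1}/dist_desc dT.
by rewrite leqNgt dist_ltn_card.
Qed.

Lemma dist_desc_child u v x : child u v -> dist_desc u x <= dist_desc v x.
Proof.
move=> uv; have [y vy ->] := dist_descE v x.
exact/dist_desc_leq/(descendant_child uv).
Qed.

Lemma dist_desc_root x : dist_desc s x = 0.
Proof.
apply/eqP; rewrite -leqn0 -(distxx x); apply: dist_desc_leq.
by rewrite /descendant distxx.
Qed.

Lemma dist_desc_leaf u x : (forall v, ~~ child u v) -> dist_desc u x = d u x.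
Proof.
move=> leaf; have [y uy ->] := dist_descE u x.
by case: (descendant_split uy) => [->|[v uv]] //; move: (leaf v); rewrite uv.
Qed.

(* The window at position [i] consists of the vertices at positions
   [i - gamma, ..., i]; truncated subtraction pads it by copies of [s]. *)
Definition window_dist (p : seq T) (i : nat) (x : T) : nat :=
  \big[minn/#|T|]_(j < gamma.+1) d (nth s (s :: p) (i - j)) x.

Section Along.
Variables (p : seq T).
Hypothesis sp : shortest_path e s p.
Local Notation v := (nth s (s :: p)).
Local Notation wd := (window_dist p).

Lemma dist_root i : i <= size p -> d s (v i) = i.
Proof. by move=> ip; rewrite -[s in d s _]/(v 0) dist_shortest_path // subn0. Qed.

Lemma shortest_path_child i : i < size p -> child (v i) (v i.+1).
Proof.
move=> ip; rewrite /child !dist_root ?eqxx ?andbT; try lia.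
exact: shortest_path_edge.
Qed.

Lemma window_distE i x :
  exists2 j, (i - gamma <= j <= i) & wd i x = d (v j) x.
Proof.
case: (bigmin_attained (fun _ : 'I_gamma.+1 => true)
         (fun j : 'I_gamma.+1 => d (v (i - j)) x) #|T|) => [wT|[j _ wj]].
  have := @bigmin_leq_cond _ (fun _ => true)
            (fun j : 'I_gamma.+1 => d (v (i - j)) x) #|T| ord0 isT.
  by rewrite wT leqNgt dist_ltn_card.
exists (i - j) => //; have := ltn_ord j; lia.
Qed.

Lemma window_dist_leq i x j : i - gamma <= j <= i -> wd i x <= d (v j) x.
Proof.
move=> ij; have jg : i - j < gamma.+1 by lia.
have := @bigmin_leq_cond _ (fun _ => true)
            (fun j : 'I_gamma.+1 => d (v (i - j)) x) #|T| (Ordinal jg) isT.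
by rewrite /= subKn //; lia.
Qed.

(* If [x] can still get closer beyond position [i] than to the window there,
   then by [sublevel_gap] it was never closer before the window. *)
Lemma window_dist_prefix i x j : i <= size p -> dist_desc (v i) x < wd i x ->
  j <= i -> wd i x <= d (v j) x.
Proof.
move=> ip unsettled ji; rewrite leqNgt; apply/negP => dj.
have [y dy dyx] := dist_descE (v i) x.
have [q [pq lq sq]] := shortest_walk (v i) y.
(* The path is redirected after position [i] towards a nearest descendant [y]. It stays a shortest
   path from [s] because [y] descends from [v i]. *)
set r := take i p ++ q.
have szt : size (take i p) = i by rewrite size_takel.
have lt : last s (take i p) = v i.
  rewrite (last_nth s) szt; case: (i) ip => //= k kp.
  by rewrite nth_take.
have vr k : k <= i -> nth s (s :: r) k = v k.
  case: k => //= k ki; rewrite nth_cat szt ki nth_take //.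
have lr : nth s (s :: r) (size r) = y.
  by rewrite -last_nth last_cat lt.
have szr : size r = i + d (v i) y by rewrite size_cat szt sq.
have sr : shortest_path e s r.
  apply/andP; split.
    rewrite cat_path lt pq andbT.
    by case/andP: sp => + _; rewrite -{1}(cat_take_drop i p) cat_path => /andP[].
  by rewrite (last_nth s) lr szr (eqP dy) dist_root.
(* With [K] just below the window distance, the last position [a] up to [i] within [K] lies before
   the window, and the next such position [b] on [r] lies after [i]. So [b] is at least
   [a + gamma + 2], against [sublevel_gap]. *)
set K := (wd i x).-1.
have exa : exists a, (a <= i) && (d (v a) x <= K) by exists j; rewrite ji /K; lia.
have [a /andP[ai da] amax] :=
  ex_maxnP exa (fun a (H : (a <= i) && _) => proj1 (andP H)).
have wa : a < i - gamma.
  rewrite ltnNge; apply/negP => ga.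
  by have := @window_dist_leq i x a ltac:(lia); move: da; rewrite /K; lia.
have exb : exists b, (a < b <= size r) && (d (nth s (s :: r) b) x <= K).
  by exists (size r); rewrite lr -dyx szr /K; lia.
case: (ex_minnP exb) => b /andP[/andP[ab br] db] bmin.
have bi : i < b.
  rewrite ltnNge; apply/negP => bi.
  by move: db; rewrite vr // => db; have := amax b; rewrite bi db /=; lia.
have := @sublevel_gap s r sr gamma x K a b pg ab br.
rewrite vr // => /(_ da db).
suff /[swap] /[apply] : forall j, a < j < b -> K < d (nth s (s :: r) j) x by lia.
move=> k kab; rewrite ltnNge; apply/negP => dk.
by have := bmin k; rewrite dk andbT; lia.
Qed.

Lemma nth_in_path i : i <= size p -> v i \in [set w in s :: p].
Proof. by move=> ip; rewrite inE mem_nth. Qed.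

Lemma dist_set_leq i x : i <= size p -> dist_set e x [set w in s :: p] <= d (v i) x.
Proof. by move=> ip; apply: bigmin_leq_cond; apply: nth_in_path. Qed.

Lemma leq_dist_set x m :
  (forall i, i <= size p -> m <= d (v i) x) -> m <= dist_set e x [set w in s :: p].
Proof.
move=> mv; apply: leq_bigmin.
  by apply: leq_trans (mv 0 _) _ => //; rewrite ltnW // dist_ltn_card.
by move=> w; rewrite inE => /(nthP s)[i ip <-]; apply: mv.
Qed.

Lemma descendant_nth i j : i <= j -> j <= size p -> descendant (v i) (v j).
Proof.
by move=> ij jp; rewrite /descendant !dist_root ?dist_shortest_path //; lia.
Qed.

(** No earlier vertex beats the window by [window_dist_prefix], and all later ones descend from
    [v i.+1], so they do not beat the charge either. *)
Lemma charged_dist i x : i < size p ->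
  dist_desc (v i) x < wd i x ->
  minn (wd i x) (d (v i.+1) x) <= dist_desc (v i.+1) x ->
  dist_set e x [set w in s :: p] = minn (wd i x) (d (v i.+1) x).
Proof.
move=> ip unsettled settled; apply/eqP; rewrite eqn_leq; apply/andP; split.
  have [j ji ->] := window_distE i x.
  by rewrite leq_min !dist_set_leq //; lia.
apply: leq_dist_set => j jp; have [ji|ij] := leqP j i.
  by apply: leq_trans (geq_minl _ _) _; apply: window_dist_prefix => //; lia.
by apply: leq_trans settled _; apply/dist_desc_leq/descendant_nth.
Qed.

Definition charge (a : T -> nat) (u v : T) : nat := \max_x charge_at (a x) u v x.

(** Charges are true distances by [charged_dist], hence at most the eccentricity. Conversely each
    [x] other than [s] is charged at the first position where it is settled; one exists because
    nothing lies beyond a leaf. *)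
Lemma ecc_charge :
  (forall w, ~~ child (last s p) w) ->
  ecc e [set w in s :: p] = \max_(i < size p) charge (wd i) (v i) (v i.+1).
Proof.
move=> leaf; apply/eqP; rewrite eqn_leq; apply/andP; split; last first.
  apply/bigmax_leqP => i _; apply/bigmax_leqP => x _; rewrite /charge_at.
  case: ifP => // /andP[unsettled settled].
  by rewrite -charged_dist //; apply: leq_bigmax.
apply/bigmax_leqP => x _.
have [->|xs] := eqVneq x s.
  by have := @dist_set_leq 0 s isT; rewrite distxx leqn0 => /eqP ->.
case: (posnP (size p)) => [p0|p_gt0].
  move: leaf; rewrite (size0nil p0) /= => leaf.
  by have := dist_desc_leaf x leaf; rewrite dist_desc_root => /esym /dist_eq0 E;
     rewrite E eqxx in xs.
pose st i := (i < size p) && (minn (wd i x) (d (v i.+1) x) <= dist_desc (v i.+1) x).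
have exi : exists i, st i.
  exists (size p).-1; rewrite /st prednK // leqnn -last_nth.
  by rewrite dist_desc_leaf // geq_minr.
case: (ex_minnP exi) => i /andP[ip settled] imin.
(* At position 0 every [x] other than [s] is still ahead. Later, failure of [st] one position
   earlier carries over, since the window at [i.+1] is contained in the window at [i] together with
   [v i.+1]. *)
have unsettled : dist_desc (v i) x < wd i x.
  case: i ip settled imin => [|i] ip _ imin.
    rewrite dist_desc_root; have [j] := window_distE 0 x.
    case: j => // _ ->; rewrite lt0n; apply/negP => /eqP /dist_eq0 E.
    by rewrite -E eqxx in xs.
  have : ~~ st i by apply/negP => /imin; rewrite ltnn.
  rewrite /st (ltnW ip) /= -ltnNge => /leq_trans; apply.
  have [j ji ->] := window_distE i.+1 x; have [jE|jne] := eqVneq j i.+1.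
    by rewrite jE geq_minr.
  by apply: leq_trans (geq_minl _ _) _; apply: window_dist_leq; lia.
rewrite (charged_dist ip unsettled settled).
apply: leq_trans (leq_bigmax (Ordinal ip)).
apply: leq_trans (leq_bigmax x).
by rewrite /charge_at unsettled settled.
Qed.

End Along.

(** * Prolonging a shortest path to a maximal one *)

Lemma shortest_path_rcons p w :
  shortest_path e s p -> child (last s p) w -> shortest_path e s (rcons p w).
Proof.
case/andP => pp /eqP dl /andP[ew /eqP dw].
by rewrite /shortest_path rcons_path pp ew last_rcons dw dl size_rcons eqxx.
Qed.

Lemma ecc_subset (A B : {set T}) : A \subset B -> ecc e B <= ecc e A.
Proof.
move=> AB; apply/bigmax_leqP => x _; apply: leq_trans (leq_bigmax x).
apply: leq_bigmin; last by move=> y yA; apply/bigmin_leq_cond/(subsetP AB).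
case: (bigmin_attained (mem B) (fun u => d u x) #|T|); rewrite /dist_set.
  by move=> ->.
by case=> i _ ->; rewrite ltnW // dist_ltn_card.
Qed.

(** Prolonging stops because a shortest path has fewer than [#|T|] edges, and a larger vertex set
    has no larger eccentricity. This reduces the optimality claim to the paths covered by
    [ecc_charge]. *)
Lemma extend_to_leaf p : shortest_path e s p ->
  exists q, [/\ shortest_path e s (p ++ q), forall w, ~~ child (last s (p ++ q)) w
              & ecc e [set w in s :: p ++ q] <= ecc e [set w in s :: p]].
Proof.
have [k] := ubnP (#|T| - size p); elim: k p => // k IH p szp sp.
case: (pickP (child (last s p))) => [w cw|leaf]; last first.
  by exists [::]; rewrite cats0; split=> // w; rewrite leaf.
have sp' := shortest_path_rcons sp cw.
have [||q [spq leaf le_ecc]] := IH (rcons p w).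
- case/andP: sp => _ /eqP dl; have := dist_ltn_card s (last s p).
  by rewrite size_rcons dl; lia.
- exact: sp'.
exists (w :: q); move: spq leaf le_ecc; rewrite cat_rcons => ? ? le_ecc.
split=> //; apply: leq_trans le_ecc _; apply: ecc_subset.
by apply/subsetP => y; rewrite !inE mem_rcons inE; case/orP=> ->; rewrite ?orbT.
Qed.

End Window.
End Distance.

(** * Coded windows *)

Section Digits.
Variables (n gamma : nat).

Definition digit (c j : nat) : nat := (c %/ n ^ j) %% n.

(** The newest vertex is the lowest digit; the remainder drops the oldest one. *)
Definition shift_in (c v : nat) : nat := (c * n + v) %% n ^ gamma.+1.

Lemma digit0 c : digit c 0 = c %% n.
Proof. by rewrite /digit expn0 divn1. Qed.

Lemma shift_in_mod c v : v < n -> shift_in c v %% n = v.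
Proof.
by move=> vn; rewrite /shift_in expnSr modn_dvdm ?dvdn_mull // modnMDl modn_small.
Qed.

Lemma digit_shift_in c v j : v < n -> j < gamma ->
  digit (shift_in c v) j.+1 = digit c j.
Proof.
move=> vn jg; have n_gt0 : 0 < n by case: n vn.
rewrite /digit /shift_in.
(* The last factor is divided away with the low digits, and the factor [n] lets the final remainder
   modulo [n] absorb the outer one. *)
have -> : n ^ gamma.+1 = n ^ (gamma - j.+1) * n * n ^ j.+1.
  by rewrite -expnSr -expnD; congr (_ ^ _); lia.
rewrite -modn_divl modn_dvdm ?dvdn_mull // expnS divnMA divnMDl //.
by rewrite (divn_small vn) addn0.
Qed.

Lemma shift_in_lt c v : 0 < n -> shift_in c v < n ^ gamma.+1.
Proof. by move=> n_gt0; rewrite ltn_mod expn_gt0 n_gt0. Qed.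

Definition repdigit (v k : nat) : nat := iter k (fun c => c * n + v) 0.

Lemma repdigit_lt v k : v < n -> repdigit v k < n ^ k.
Proof.
move=> vn; elim: k => [|k IH]; first by rewrite expn0.
by rewrite /= -/(repdigit v k) expnSr; nia.
Qed.

Lemma digit_repdigit v k j : v < n -> j < k -> digit (repdigit v k) j = v.
Proof.
move=> vn; have n_gt0 : 0 < n by case: n vn.
elim: k j => // k IH [|j] jk; rewrite /= -/(repdigit v k).
  by rewrite digit0 modnMDl modn_small.
by rewrite /digit expnS divnMA divnMDl // (divn_small vn) addn0 -/(digit _ _) IH.
Qed.

End Digits.

(** * The dynamic program over codes of windows *)

Section Codes.
Variables (n : nat) (e : rel 'I_n) (adj : 'I_n -> seq 'I_n).
Variables (gamma : nat) (s : 'I_n).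
Hypotheses (graph_e : connected_simple_graph e).
Hypotheses (adjP : adjacency_lists e adj) (pg : pg_at_most e gamma).

(** The program computes with naturals, the graph lemmas with ordinals; the default [s] only makes
    the translation total. *)
Definition vtx (k : nat) : 'I_n := insubd s k.
Definition nbrs (u : nat) : seq nat := map val (adj (vtx u)).
Definition distn (u v : nat) : nat := dist e (vtx u) (vtx v).
(** Adjacency is left out because the test is applied to members of [nbrs u]; see [child_nbrs]. *)
Definition childn (u v : nat) : bool := distn s v == (distn s u).+1.
Definition dist_descn (u x : nat) : nat := dist_desc e s (vtx u) (vtx x).

Local Notation next := (shift_in n gamma).
Local Notation start := (repdigit n s gamma.+1).

(** Starting from the last vertex, as the program does, makes every intermediate value a distance
    and hence smaller than [n]. *)
Fixpoint code_dist (k c x : nat) : nat :=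
  if k is k'.+1 then minn (code_dist k' c x) (distn (digit n c k') x)
  else distn (c %% n) x.

Definition code_charge_at (c v x : nat) : nat :=
  let a := code_dist gamma.+1 c x in
  let b := minn a (distn v x) in
  if (dist_descn (c %% n) x < a) && (b <= dist_descn v x) then b else 0.

Definition code_charge (c v : nat) : nat := \max_(0 <= x < n) code_charge_at c v x.

(* [nx c] is [0] when the last vertex of the window has no child, and otherwise
   the successor of an optimal child. *)
Definition dp_eqn (l : seq nat) (G nx : nat -> nat) (c : nat) : Prop :=
  let opt v := maxn (code_charge c v) (G (next c v)) in
  [/\ nx c = 0, G c = 0 & forall v, v \in l -> ~~ childn (c %% n) v] \/
  exists v, [/\ v \in l, childn (c %% n) v, nx c = v.+1, G c = opt v
    & forall w, w \in l -> childn (c %% n) w -> G c <= opt w].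

Lemma order_gt0 : 0 < n. Proof. exact: leq_ltn_trans (ltn_ord s). Qed.

Lemma vtxK k : k < n -> vtx k = k :> nat.
Proof. by move=> kn; rewrite /vtx val_insubd kn. Qed.

Lemma vtx_val (u : 'I_n) : vtx u = u.
Proof. exact: valKd. Qed.

Lemma mem_nbrs (u v : 'I_n) : ((v : nat) \in nbrs u) = e u v.
Proof.
rewrite /nbrs vtx_val mem_map; last exact: val_inj.
by have [_ ->] := adjP u.
Qed.

Lemma nbrs_lt u v : v \in nbrs u -> v < n.
Proof. by case/mapP => w _ ->; apply: ltn_ord. Qed.

Lemma child_nbrs u (v : 'I_n) : child e s u v = ((v : nat) \in nbrs u) && childn u v.
Proof. by rewrite mem_nbrs /child /childn /distn !vtx_val. Qed.

Lemma dist_descnE u x : dist_descn u x = dist_desc e s (vtx u) (vtx x).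
Proof. by []. Qed.

Lemma code_charge_atE c v x : code_charge_at c v x =
  if (dist_descn (c %% n) x < code_dist gamma.+1 c x) &&
     (minn (code_dist gamma.+1 c x) (distn v x) <= dist_descn v x)
  then minn (code_dist gamma.+1 c x) (distn v x) else 0.
Proof. by []. Qed.

Lemma nbrs_vtx u : nbrs (vtx u) = nbrs u.
Proof. by rewrite /nbrs vtx_val. Qed.

Definition code (p : seq 'I_n) : nat := foldl next start (map val p).

Lemma code_rcons p v : code (rcons p v) = next (code p) v.
Proof. by rewrite /code map_rcons -cats1 foldl_cat. Qed.

Lemma code_lt p : code p < n ^ gamma.+1.
Proof.
case/lastP: p => [|p v]; first exact/repdigit_lt/ltn_ord.
by rewrite code_rcons shift_in_lt // order_gt0.
Qed.

(** Reading before the beginning yields position 0 by truncated subtraction, in agreement with the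
    start code, all of whose digits are [s]. *)
Lemma digit_code p j : j <= gamma -> digit n (code p) j = nth s (s :: p) (size p - j).
Proof.
elim/last_ind: p j => [|p v IH] j jg; first by rewrite digit_repdigit.
rewrite code_rcons size_rcons; case: j jg => [|j] jg.
  by rewrite digit0 shift_in_mod // subn0 /= nth_rcons ltnn eqxx.
rewrite digit_shift_in // IH ?subSS; last exact: ltnW.
by rewrite -rcons_cons nth_rcons /= ltnS leq_subr.
Qed.

Lemma code_mod p : code p %% n = last s p.
Proof. by rewrite -digit0 digit_code // subn0 -last_nth. Qed.

Lemma code_dist_window p x :
  code_dist gamma.+1 (code p) x = window_dist e s gamma p (size p) (vtx x).
Proof.
have att k : k <= gamma.+1 -> exists2 j, j <= gamma &
    code_dist k (code p) x = distn (digit n (code p) j) x.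
  elim: k => [|k IH] kg; first by exists 0; rewrite // digit0.
  have [j jg jE] := IH (ltnW kg); rewrite /= {1}/minn.
  by case: ifP; [exists j|exists k].
have low k j : j < k -> code_dist k (code p) x <= distn (digit n (code p) j) x.
  elim: k => // k IH; rewrite ltnS leq_eqVlt => /orP[/eqP->|/IH]; first exact: geq_minr.
  exact/leq_trans/geq_minl.
have dig j : j <= gamma -> distn (digit n (code p) j) x =
    dist e (nth s (s :: p) (size p - j)) (vtx x).
  by move=> jg; rewrite digit_code // /distn vtx_val.
apply/eqP; rewrite eqn_leq; apply/andP; split.
  apply: leq_bigmin; first by have [j _ ->] := att gamma.+1 (leqnn _);
    apply/ltnW/dist_ltn_card.
  by move=> j _; rewrite -dig ?low // -ltnS.
have [j jg ->] := att gamma.+1 (leqnn _); rewrite dig //.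
exact: (bigmin_leq_cond (P := xpredT)
  (fun j : 'I_gamma.+1 => dist e (nth s (s :: p) (size p - j)) (vtx x)) _
  (i := Ordinal (jg : j < gamma.+1))).
Qed.

Lemma code_chargeE p (v : 'I_n) :
  code_charge (code p) v
  = charge e s (window_dist e s gamma p (size p)) (last s p) v.
Proof.
rewrite /code_charge big_mkord; apply: eq_bigr => x _.
by rewrite /code_charge_at code_dist_window code_mod /dist_descn /distn !vtx_val.
Qed.

Definition total_charge (p : seq 'I_n) : nat :=
  \max_(i < size p) code_charge (code (take i p)) (nth s p i).

Lemma total_charge_rcons p v :
  total_charge (rcons p v) = maxn (total_charge p) (code_charge (code p) v).
Proof.
rewrite /total_charge size_rcons big_ord_recr /=; congr maxn.
  apply: eq_bigr => i _; rewrite nth_rcons ltn_ord -cats1 takel_cat //.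
  exact: ltnW.
by rewrite nth_rcons ltnn eqxx -cats1 takel_cat // take_size.
Qed.

Lemma ecc_total_charge p : shortest_path e s p ->
  (forall w, ~~ child e s (last s p) w) ->
  ecc e [set w in s :: p] = total_charge p.
Proof.
move=> sp leaf; rewrite (ecc_charge graph_e pg sp leaf).
apply: eq_bigr => i _; have ip := ltn_ord i.
have szt : size (take i p) = i by rewrite size_takel // ltnW.
have vt j : j <= i -> nth s (s :: p) j = nth s (s :: take i p) j.
  by case: j => //= j ji; rewrite nth_take.
rewrite code_chargeE szt (last_nth s) szt -vt //; apply: eq_bigr => x _.
congr charge_at; apply: eq_bigr => j _; congr dist; apply: vt; exact: leq_subr.
Qed.

Variables G nx : nat -> nat.
Hypothesis dp : forall c, c < n ^ gamma.+1 -> dp_eqn (nbrs (c %% n)) G nx c.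

(** Every step of a maximal continuation is one of the candidates over which [G] is minimal, so [G]
    is at most the largest charge met on the way. *)
Lemma dp_lower p q : shortest_path e s (p ++ q) ->
  (forall w, ~~ child e s (last s (p ++ q)) w) ->
  G (code p) <= maxn (total_charge p) (total_charge (p ++ q)).
Proof.
elim: q p => [|v q IH] p spq leaf.
  rewrite cats0 in leaf; case: (dp (code_lt p)) => [[_ -> _]|] //.
  case=> v [vn vc _ _ _]; have := leaf (vtx v).
  by rewrite child_nbrs -code_mod (vtxK (nbrs_lt vn)) vn vc.
have cv : child e s (last s p) v.
  have := @shortest_path_child _ _ graph_e s _ spq (size p).
  rewrite -cat_cons !nth_cat /= ltnS leqnn ltnn subnn -last_nth => ->//.
  by rewrite size_cat /= addnS ltnS leq_addr.
have := IH (rcons p v); rewrite cat_rcons => /(_ spq leaf) IHv.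
have tot_le : total_charge (rcons p v) <= total_charge (p ++ v :: q).
  rewrite -cat_rcons /total_charge; apply/bigmax_leqP => i _.
  have ip : i < size (rcons p v ++ q).
    by rewrite size_cat; apply: leq_trans (ltn_ord i) (leq_addr _ _).
  apply: leq_trans (leq_bigmax (Ordinal ip)) => /=.
  by rewrite nth_cat ltn_ord takel_cat // ltnW.
move: cv; rewrite child_nbrs => /andP[vn vc].
case: (dp (code_lt p)) => [[_ _ /(_ v)]|[w [_ _ _ _ /(_ v)]]]; rewrite code_mod.
  by move=> /(_ vn); rewrite vc.
move=> /(_ vn vc) GE.
have := total_charge_rcons p v; rewrite -code_rcons in GE.
move: GE IHv tot_le; move: (G _) (G _) (code_charge _ _) => g g' ch.
by move: (total_charge _) (total_charge _) (total_charge _); lia.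
Qed.

Lemma dp_lower_start q : shortest_path e s q ->
  G start <= ecc e [set w in s :: q].
Proof.
move=> sq; have [r [sqr leaf le_ecc]] := extend_to_leaf graph_e sq.
apply: leq_trans le_ecc; rewrite ecc_total_charge //.
have := @dp_lower [::] (q ++ r) sqr leaf.
by rewrite /total_charge /= big_ord0 max0n.
Qed.

(** Invariant of following [nx]: the charges already incurred and the optimum still ahead both stay
    within the optimum at the start. When [nx] becomes 0 the path is maximal and the charges are its
    eccentricity. *)
Definition dp_path (p : seq 'I_n) : Prop :=
  shortest_path e s p /\ maxn (total_charge p) (G (code p)) <= G start.

Lemma dp_path_nil : dp_path [::].
Proof.
split; first by rewrite /shortest_path /= distxx.
by rewrite /total_charge big_ord0 max0n.
Qed.

Lemma dp_path_step p : dp_path p -> nx (code p) != 0 ->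
  let v := (nx (code p)).-1 in v < n /\ dp_path (rcons p (vtx v)).
Proof.
case=> sp le_tot nx0 /=.
case: (dp (code_lt p)) => [[H]|[v [vn vc nE GE _]]]; first by rewrite H in nx0.
rewrite nE /=; have vlt := nbrs_lt vn; split=> //; split.
  by apply: shortest_path_rcons => //; rewrite child_nbrs vtxK // -code_mod vn.
rewrite total_charge_rcons code_rcons vtxK //.
by move: le_tot GE; lia.
Qed.

Lemma dp_path_optimal p q : dp_path p -> nx (code p) = 0 ->
  shortest_path e s q -> ecc e [set w in s :: p] <= ecc e [set w in s :: q].
Proof.
case=> sp le_tot nx0 /dp_lower_start; apply: leq_trans.
rewrite ecc_total_charge //; first by move: le_tot; lia.
move=> w; rewrite child_nbrs -code_mod.
case: (dp (code_lt p)) => [[_ _ leaf]|[v [_ _]]]; last by rewrite nx0.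
by apply/negP => /andP[/leaf/negP].
Qed.

End Codes.

(** * Program logic *)

(** [eval] is split into the value without a word bound and the condition [fits] that no
    intermediate result overflows, so values are found by rewriting and bounds by arithmetic. *)
Fixpoint den (st : state) (x : expr) : nat :=
  match x with
  | Cst c => c
  | Var x => reg st x
  | Get a x1 => arr st a (den st x1)
  | Op o x1 x2 => binop_sem o (den st x1) (den st x2)
  end.

Fixpoint fits (W : nat) (st : state) (x : expr) : Prop :=
  match x with
  | Cst _ | Var _ => den st x < W
  | Get _ x1 => fits W st x1 /\ den st x < W
  | Op _ x1 x2 => [/\ fits W st x1, fits W st x2 & den st x < W]
  end.

Lemma eval_den W st x : fits W st x -> eval W st x = Some (den st x).
Proof.
elim: x => [c|x|a x IH|o x IHx y IHy] /=; rewrite /word.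
- by move=> ->.
- by move=> ->.
- by case=> /IH -> /= ->.
by case=> /IHx -> /IHy -> /= ->.
Qed.

Section WP.
Variable W : nat.

Definition wp (c : cmd) (st : state) (Q : nat -> state -> Prop) : Prop :=
  exists t st', exec W c st t st' /\ Q t st'.

Lemma wp_conseq c st (Q Q' : nat -> state -> Prop) :
  wp c st Q -> (forall t st', Q t st' -> Q' t st') -> wp c st Q'.
Proof. by case=> t [st' [ex q]] H; exists t, st'; split=> //; apply: H. Qed.

Lemma wp_skip st (Q : nat -> state -> Prop) : Q 1 st -> wp Skip st Q.
Proof. by exists 1, st; split=> //; constructor. Qed.

Lemma wp_assign x a st (Q : nat -> state -> Prop) :
  fits W st a -> Q (cost a).+1 (set_reg st x (den st a)) -> wp (Assign x a) st Q.
Proof.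
move=> f q; exists (cost a).+1, (set_reg st x (den st a)); split=> //.
by constructor; apply: eval_den.
Qed.

Lemma wp_put b x y st (Q : nat -> state -> Prop) :
  fits W st x -> fits W st y ->
  Q (cost x + cost y).+1 (set_arr st b (den st x) (den st y)) ->
  wp (Put b x y) st Q.
Proof.
move=> fx fy q; eexists _, _; split; last exact: q.
by constructor; apply: eval_den.
Qed.

Lemma wp_seq c1 c2 st (Q : nat -> state -> Prop) :
  wp c1 st (fun t1 st1 => wp c2 st1 (fun t2 => Q (t1 + t2))) ->
  wp (Seq c1 c2) st Q.
Proof.
case=> t1 [st1 [ex1 [t2 [st2 [ex2 q]]]]].
by exists (t1 + t2), st2; split=> //; apply: ExecSeq ex1 ex2.
Qed.

Lemma wp_if x c1 c2 st (Q : nat -> state -> Prop) :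
  fits W st x ->
  (den st x != 0 -> wp c1 st (fun t => Q (cost x + t).+1)) ->
  (den st x = 0 -> wp c2 st (fun t => Q (cost x + t).+1)) ->
  wp (If x c1 c2) st Q.
Proof.
move=> fx H1 H2.
have [t [st' [ex q]]] :
    wp (if den st x != 0 then c1 else c2) st (fun t => Q (cost x + t).+1).
  by case: eqP => [/H2|/eqP/H1].
by exists (cost x + t).+1, st'; split=> //; apply: ExecIf ex; apply: eval_den.
Qed.

(* [B] is the remaining time budget; its decrease makes the loop terminate. *)
Lemma wp_while (I : nat -> state -> Prop) x c (Q : state -> Prop) :
  (forall B st, I B st -> fits W st x /\
     if den st x == 0 then cost x < B /\ Q st
     else wp c st (fun t st' => exists2 B', I B' st' & cost x + t + B' < B)) ->
  forall B st, I B st -> wp (While x c) st (fun t st' => t <= B /\ Q st').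
Proof.
move=> step; elim/ltn_ind => B IH st iB; have [fx] := step _ _ iB.
case: eqP => [x0 [lt q]|/eqP x0 [t1 [st1 [ex1 [B' iB' lt]]]]].
  exists (cost x).+1, st; split=> //.
  by apply: ExecWhileFalse; rewrite eval_den ?x0.
have [|t2 [st2 [ex2 [le2 q]]]] := IH B' _ st1 iB'; first by lia.
exists (cost x + t1 + t2).+1, st2; split; last by split=> //; lia.
by apply: ExecWhileTrue (eval_den fx) x0 ex1 ex2.
Qed.

Definition For (x : nat) (a b : expr) (c : cmd) : cmd :=
  Seq (Assign x a)
      (While (Op Lt (Var x) b) (Seq c (Assign x (Op Add (Var x) (Cst 1))))).

(** The invariant carries the time [T] spent so far, for bodies whose time depends on the state, as
    in breadth-first search. The overhead [cost eb + 7] of a round is its test and its increment. *)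
Lemma wp_for_acc (I : nat -> nat -> state -> Prop) x ea eb c a b st :
  1 < W -> b < W -> a <= b ->
  fits W st ea -> den st ea = a ->
  I a 0 (set_reg st x a) ->
  (forall i T st', a <= i <= b -> reg st' x = i -> I i T st' ->
     fits W st' eb /\ den st' eb = b) ->
  (forall i T st', a <= i < b -> reg st' x = i -> I i T st' ->
     wp c st' (fun t st1 => reg st1 x = i /\
       I i.+1 (T + t + (cost eb + 7)) (set_reg st1 x i.+1))) ->
  wp (For x ea eb c) st (fun t st' =>
    exists2 T, t <= T + (cost ea + cost eb + 4) & I b T st').
Proof.
move=> W1 bW ab fa da Ia Ib Ic; apply: wp_seq; apply: wp_assign => //.
rewrite da; set st0 := set_reg _ _ _.
suff run k i T st' : b - i = k -> a <= i <= b -> reg st' x = i -> I i T st' ->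
    wp (While (Op Lt (Var x) eb) (Seq c (Assign x (Op Add (Var x) (Cst 1))))) st'
       (fun t st1 => exists2 T', T + t <= T' + (cost eb + 3) & I b T' st1).
  have xa : reg st0 x = a by rewrite /st0 /= eqxx.
  have [||||t [st1 [ex [T' le1 IT']]]] := run (b - a) a 0 st0 => //; first by lia.
  by exists t, st1; split=> //; exists T' => //; lia.
elim: k i T st' => [|k IH] i T st' bi aib xi Ii.
  have ib : i = b by lia.
  have [fb db] := Ib _ _ _ aib xi Ii.
  exists (cost (Op Lt (Var x) eb)).+1, st'; split.
    apply: ExecWhileFalse; rewrite eval_den /=; first by rewrite db xi ib ltnn.
    by split=> //; [lia|rewrite db xi ib ltnn; lia].
  by exists T; rewrite -?ib //=; lia.
have [fb db] := Ib _ _ _ aib xi Ii.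
have [|t1 [st1 [ex1 [x1 I1]]]] := Ic i T st' _ xi Ii; first by lia.
have [|||t2 [st2 [ex2 [T2 le2 I2]]]] := IH i.+1 _ _ _ _ _ I1; try lia.
  by rewrite /= eqxx.
eexists _, st2; split.
  apply: ExecWhileTrue ex2; [apply: eval_den| |apply: ExecSeq ex1 _].
  - by split=> //=; [lia|rewrite db xi; lia].
  - by rewrite /= db xi; lia.
  apply: (ExecAssign _ (v := i.+1)).
  have -> : i.+1 = den st1 (Op Add (Var x) (Cst 1)) by rewrite /= x1 addn1.
  by apply: eval_den; rewrite /= x1; split=> //; lia.
by exists T2; rewrite //=; lia.
Qed.

Lemma wp_for (f : nat -> nat) (I : nat -> state -> Prop) x ea eb c a b st :
  1 < W -> b < W -> a <= b ->
  fits W st ea -> den st ea = a ->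
  I a (set_reg st x a) ->
  (forall i st', a <= i <= b -> reg st' x = i -> I i st' ->
     fits W st' eb /\ den st' eb = b) ->
  (forall i st', a <= i < b -> reg st' x = i -> I i st' ->
     wp c st' (fun t st1 => [/\ t <= f i, reg st1 x = i &
       I i.+1 (set_reg st1 x i.+1)])) ->
  wp (For x ea eb c) st (fun t st' =>
    t <= \sum_(a <= i < b) (f i + (cost eb + 7)) + (cost ea + cost eb + 4)
    /\ I b st').
Proof.
move=> W1 bW ab fa da Ia Ib Ic.
pose J i T st' := T <= \sum_(a <= k < i) (f k + (cost eb + 7)) /\ I i st'.
apply: wp_conseq (wp_for_acc (I := J) W1 bW ab fa da _ _ _) _.
- by split.
- by move=> i T st' ai xi [_]; apply: Ib.
- move=> i T st' ai xi [TT Ii]; apply: wp_conseq (Ic i st' ai xi Ii) _.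
  move=> t st1 [tf x1 I1]; split=> //; split=> //.
  by rewrite big_nat_recr /=; lia.
by move=> t st' [T tT [TT Ib']]; split=> //; lia.
Qed.

Lemma wp_for_const (F : nat) (I : nat -> state -> Prop) x ea eb c a b st :
  1 < W -> b < W -> a <= b ->
  fits W st ea -> den st ea = a ->
  I a (set_reg st x a) ->
  (forall i st', a <= i <= b -> reg st' x = i -> I i st' ->
     fits W st' eb /\ den st' eb = b) ->
  (forall i st', a <= i < b -> reg st' x = i -> I i st' ->
     wp c st' (fun t st1 => [/\ t <= F, reg st1 x = i &
       I i.+1 (set_reg st1 x i.+1)])) ->
  wp (For x ea eb c) st (fun t st' =>
    t <= (b - a) * (F + (cost eb + 7)) + (cost ea + cost eb + 4) /\ I b st').
Proof.
move=> W1 bW ab fa da Ia Ib Ic.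
apply: wp_conseq (wp_for (f := fun _ => F) W1 bW ab fa da Ia Ib Ic) _.
by move=> t st'; rewrite sum_nat_const_nat.
Qed.

End WP.

(** Frame condition: only registers in [R] and arrays in [A] may change. The lists are concrete, so
    [read_state] and [same_tac] decide membership by computation. *)
Definition same (R A : seq nat) (st st' : state) : Prop :=
  (forall x, x \notin R -> reg st' x = reg st x) /\
  (forall a i, a \notin A -> arr st' a i = arr st a i).

Lemma same_refl R A st : same R A st st.
Proof. by []. Qed.

Lemma same_trans R A st1 st2 st3 :
  same R A st1 st2 -> same R A st2 st3 -> same R A st1 st3.
Proof.
by case=> r1 a1 [r2 a2]; split=> [x|a i] xR; [rewrite r2 ?r1|rewrite a2 ?a1].
Qed.

Lemma same_weak (R A R' A' : seq nat) st1 st2 :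
  same R A st1 st2 -> all (mem R') R -> all (mem A') A -> same R' A' st1 st2.
Proof.
case=> r a /allP RR /allP AA; split=> [x|b i] xR.
  by apply: r; apply: contra xR => /RR.
by apply: a; apply: contra xR => /AA.
Qed.

Lemma same_set_reg (R A : seq nat) st st' x v :
  x \in R -> same R A st st' -> same R A st (set_reg st' x v).
Proof.
move=> xR [r a]; split=> //= y yR; case: eqP => [yx|_]; last exact: r.
by rewrite yx xR in yR.
Qed.

Lemma same_set_arr (R A : seq nat) st st' b i v :
  b \in A -> same R A st st' -> same R A st (set_arr st' b i v).
Proof.
move=> bA [r a]; split=> //= c j cA; case: eqP => [cb|_] /=; last exact: a.
by rewrite cb bA in cA.
Qed.

Lemma same_reg R A st st' x : same R A st st' -> x \notin R -> reg st' x = reg st x.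
Proof. by case=> r _; apply: r. Qed.

Lemma same_arr R A st st' a i :
  same R A st st' -> a \notin A -> arr st' a i = arr st a i.
Proof. by case=> _; apply. Qed.

(** * Breadth-first search over pairs of vertices *)

Lemma pair_lt n a b c : a < b -> c < n -> a * n + c < b * n.
Proof. by nia. Qed.

Section Bfs.
Variables (n : nat) (e : rel 'I_n) (adj : 'I_n -> seq 'I_n) (s : 'I_n).
Hypotheses (graph_e : connected_simple_graph e) (adjP : adjacency_lists e adj).

Local Notation nbrs := (nbrs adj s).
Local Notation distn := (distn e s).
Let n_gt0 : 0 < n := order_gt0 s.

Lemma distnn u : distn u u = 0.
Proof. exact: distxx. Qed.

Lemma distn_lt u v : distn u v < n.
Proof. by have := dist_ltn_card graph_e (vtx s u) (vtx s v); rewrite card_ord. Qed.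

Lemma distn_eq0 u v : u < n -> v < n -> distn u v = 0 -> u = v.
Proof.
move=> un vn /(dist_eq0 graph_e)/(congr1 val) /=.
by rewrite !vtxK.
Qed.

Lemma distn_nbr u v w : w \in nbrs v -> distn u w <= (distn u v).+1.
Proof.
move=> wv; have wn := nbrs_lt wv; have := dist_triangle graph_e (vtx s v) (vtx s u) (vtx s w).
have -> : w = vtx s w by rewrite vtxK.
have : e (vtx s v) (vtx s w).
  by rewrite -(mem_nbrs s adjP) vtxK // nbrs_vtx.
by move=> /dist_edge; rewrite /distn !vtx_val; lia.
Qed.

Lemma distn_pred u w k : w < n -> distn u w = k.+1 ->
  exists v, [/\ v < n, w \in nbrs v & distn u v = k].
Proof.
move=> wn /(dist_pred graph_e)[v evw dv]; exists v; split=> //.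
  by have := mem_nbrs s adjP v (vtx s w); rewrite evw vtxK.
by rewrite /distn vtx_val.
Qed.

(** The pair of a source [u] and a vertex [v] is the number [u * n + v]. The search runs in [n]
    disjoint copies of the graph, with all sources queued at the start. *)
Definition pair_dist (p : nat) : nat := distn (p %/ n) (p %% n).
Lemma pair_distE p : pair_dist p = distn (p %/ n) (p %% n).
Proof. by []. Qed.

Definition move_pair (p w : nat) : nat := p - p %% n + w.

Lemma move_pairE p w : move_pair p w = p %/ n * n + w.
Proof. by rewrite /move_pair {1}(divn_eq p n) addnK. Qed.

Lemma move_pair_lt p w : p < n * n -> w < n -> move_pair p w < n * n.
Proof. by move=> pn wn; rewrite move_pairE pair_lt // ltn_divLR. Qed.

Lemma move_pair_div p w : w < n -> move_pair p w %/ n = p %/ n.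
Proof. by move=> wn; rewrite move_pairE divnMDl // (divn_small wn) addn0. Qed.

Lemma move_pair_mod p w : w < n -> move_pair p w %% n = w.
Proof. by move=> wn; rewrite move_pairE modnMDl modn_small. Qed.

Lemma pair_dist_move p w : w < n -> pair_dist (move_pair p w) = distn (p %/ n) w.
Proof. by move=> wn; rewrite /pair_dist move_pair_div ?move_pair_mod. Qed.

(* [h] is the head of the queue [q], which keeps the pairs already removed. *)
Record bfs (h : nat) (q : seq nat) : Prop := Bfs {
  bfs_uniq : uniq q;
  bfs_bound : forall p, p \in q -> p < n * n;
  bfs_sorted : forall i j, i <= j -> j < size q ->
    pair_dist (nth 0 q i) <= pair_dist (nth 0 q j);
  bfs_near : h < size q -> forall i, i < size q ->
    pair_dist (nth 0 q i) <= (pair_dist (nth 0 q h)).+1;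
  bfs_diag : forall u, u < n -> u * n + u \in q;
  bfs_closed : forall i w, i < h -> i < size q ->
    w \in nbrs (nth 0 q i %% n) -> move_pair (nth 0 q i) w \in q }.

Lemma bfs_start : bfs 0 (mkseq (fun u => u * n + u) n).
Proof.
have d0 i : i < n -> pair_dist (nth 0 (mkseq (fun u => u * n + u) n) i) = 0.
  move=> ni; rewrite nth_mkseq // /pair_dist divnMDl // modnMDl (divn_small ni).
  by rewrite modn_small // addn0 distnn.
split=> //.
- by apply/mkseq_uniqP => i j _ _ /=; nia.
- by move=> p /mapP[u]; rewrite mem_iota => un ->; apply: pair_lt.
- by move=> i j ij; rewrite size_mkseq => jn; rewrite !d0 //; lia.
- by move=> _ i; rewrite size_mkseq => ni; rewrite d0.
by move=> u un; apply/mapP; exists u; rewrite // mem_iota.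
Qed.

(** Induction on the distance of [p]: its predecessor is queued and closer than [k], hence already
    processed, and [bfs_closed] then gives [p]. *)
Lemma bfs_complete h q p k : bfs h q ->
  (forall i, i < size q -> pair_dist (nth 0 q i) < k -> i < h) ->
  p < n * n -> pair_dist p <= k -> p \in q.
Proof.
case=> _ qb _ _ qd qc done_k pn; have [d] := ubnP (pair_dist p).
have pE r : r < n * n -> r = r %/ n * n + r %% n /\ r %% n < n /\ r %/ n < n.
  by move=> rn; rewrite -divn_eq ltn_mod n_gt0 ltn_divLR.
elim: d p pn => // d IH p pn; have [pe [pm pd]] := pE p pn.
case dp : (pair_dist p) => [|c] cd ck.
  by have dm := distn_eq0 pd pm dp; rewrite pe -dm; apply: qd.
have [v [vn vw dv]] := distn_pred pm dp.
have vp : move_pair p v \in q.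
  by apply: IH; rewrite ?move_pair_lt // pair_dist_move // dv; lia.
have [i iq iE] := nthP 0 vp.
have ih : i < h by apply: done_k => //; rewrite iE pair_dist_move // dv; lia.
have := qc i (p %% n) ih iq; rewrite iE move_pair_mod // => /(_ vw).
by rewrite move_pairE move_pair_div // -pe.
Qed.

(** If all queued pairs were processed, connectedness would have queued all [n * n] pairs. So a loop
    of [n * n] rounds never reads past the end of the queue. *)
Lemma bfs_progress h q : bfs h q -> h < n * n -> h < size q.
Proof.
move=> bq hn; rewrite ltnNge; apply/negP => qh.
have all_q p : p < n * n -> p \in q.
  move=> pn; apply: (bfs_complete bq (k := pair_dist p)) => // i iq _.
  exact: leq_trans iq qh.
have : size (iota 0 (n * n)) <= size q.
  by apply: uniq_leq_size (iota_uniq _ _) _ => p; rewrite mem_iota; apply: all_q.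
by rewrite size_iota; lia.
Qed.

Lemma bfs_size h q : bfs h q -> size q <= n * n.
Proof.
case=> qu qb _ _ _ _; rewrite -[n * n](size_iota 0); apply: uniq_leq_size => //.
by move=> p /qb; rewrite mem_iota.
Qed.

Lemma bfs_full q : bfs (n * n) q -> forall p, p < n * n -> p \in q.
Proof.
move=> bq p pn; apply: (bfs_complete bq (k := pair_dist p)) => // i iq _.
exact: leq_trans iq (bfs_size bq).
Qed.

Lemma bfs_discover h q w : bfs h q -> h < size q ->
  w \in nbrs (nth 0 q h %% n) -> move_pair (nth 0 q h) w \notin q ->
  bfs h (rcons q (move_pair (nth 0 q h) w)) /\
  pair_dist (move_pair (nth 0 q h) w) = (pair_dist (nth 0 q h)).+1.
Proof.
move=> bq hq wv wq; have [qu qb qs qn qd qc] := bq; have wn := nbrs_lt wv.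
set x := nth 0 q h in wv wq *; set y := move_pair x w in wq *.
have xn : x < n * n by apply/qb/mem_nth.
have yn : y < n * n by apply: move_pair_lt.
(* Otherwise [y] would be no farther than [x]. All queued pairs closer than [x] precede the head by
   sortedness, so [bfs_complete] would have [y] in the queue. *)
have dy : pair_dist y = (pair_dist x).+1.
  apply/eqP; rewrite eqn_leq pair_dist_move // distn_nbr //= ltnNge.
  apply: contra wq => dw; apply: (bfs_complete bq (k := pair_dist x)) => //.
    by move=> i iq dx; rewrite ltnNge; apply: contraL dx => hi; rewrite -leqNgt qs.
  by rewrite pair_dist_move.
have nthq i : i < size q -> nth 0 (rcons q y) i = nth 0 q i by rewrite nth_rcons => ->.
have nthy : nth 0 (rcons q y) (size q) = y by rewrite nth_rcons ltnn eqxx.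
split=> //; split.
- by rewrite rcons_uniq wq.
- by move=> p; rewrite mem_rcons inE => /predU1P[->|/qb].
- move=> i j ij; rewrite size_rcons ltnS leq_eqVlt => /predU1P[jE|jq].
    rewrite jE nthy; move: ij; rewrite jE leq_eqVlt => /predU1P[->|iq].
      by rewrite nthy.
    by rewrite nthq // dy qn.
  by rewrite !nthq ?qs //; lia.
- rewrite nthq // => _ i; rewrite size_rcons ltnS leq_eqVlt => /predU1P[->|iq].
    by rewrite nthy dy.
  by rewrite nthq // qn.
- by move=> u un; rewrite mem_rcons inE qd ?orbT.
move=> i v ih _; have iq : i < size q by lia.
by rewrite nthq // => /(qc _ _ ih iq) vq; rewrite mem_rcons inE vq orbT.
Qed.

Lemma bfs_advance h q : bfs h q -> h < size q ->
  (forall w, w \in nbrs (nth 0 q h %% n) -> move_pair (nth 0 q h) w \in q) ->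
  bfs h.+1 q.
Proof.
case=> qu qb qs qn qd qc hq done_h; split=> //.
  move=> hq' i iq; apply: leq_trans (qn hq i iq) _.
  by rewrite ltnS qs.
move=> i w; rewrite ltnS leq_eqVlt => /predU1P[-> _|]; [exact: done_h|exact: qc].
Qed.

End Bfs.

(** * The algorithm *)

Ltac read_state :=
  repeat match goal with
  | H : same _ _ _ ?st |- context [reg ?st ?x] =>
      rewrite (same_reg (x := x) H isT)
  | H : same _ _ _ ?st |- context [arr ?st ?a ?i] =>
      rewrite (same_arr (a := a) i H isT)
  end.

Ltac same_tac :=
  repeat first
    [ assumption
    | apply: same_refl
    | apply: same_set_reg; first exact: isT
    | apply: same_set_arr; first exact: isT
    | match goal with
      | H : same _ _ ?st1 ?st |- same _ _ _ ?st =>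
          first
            [ apply: (same_weak H); exact: isT
            | eapply same_trans; last (apply: (same_weak H); exact: isT) ]
      end ].

(** Loops over pairs use one counter, decoded by quotient and remainder; this turns their total time
    into a double sum. *)
Lemma sum_divn_modn m a (F : nat -> nat -> nat) : 0 < m ->
  \sum_(0 <= p < a * m) F (p %/ m) (p %% m) = \sum_(0 <= u < a) \sum_(0 <= v < m) F u v.
Proof.
move=> m_gt0; elim: a => [|a IH]; first by rewrite mul0n !big_geq.
rewrite mulSn addnC (@big_cat_nat _ _ _ (a * m)) /= ?leq_addr //.
rewrite big_nat_recr //= IH; congr addn.
rewrite -{1}[a * m]add0n big_addn addKn; apply: eq_big_nat => v /andP[_ vm].
by rewrite [v + _]addnC divnMDl // modnMDl (divn_small vm) (modn_small vm) addn0.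
Qed.

Section Program.
Variables (n : nat) (e : rel 'I_n) (adj : 'I_n -> seq 'I_n).
Variables (gamma : nat) (s : 'I_n).
Hypotheses (graph_e : connected_simple_graph e).
Hypotheses (adjP : adjacency_lists e adj).

Local Notation nbrs := (nbrs adj s).
Local Notation distn := (distn e s).
Local Notation M := (n ^ gamma.+1).
Local Notation deg u := (size (nbrs u)).

Variable W : nat.
(** The largest values are the counter of [optimize] and the addresses [c * n + x], bounded by
    [n * M], and the codes of pairs, bounded by [n * n]; the rest is slack for sums and
    constants. *)
Hypothesis HW : n * M + n * n + n + gamma + 20 < W.

Let n_gt0 : 0 < n := order_gt0 s.

Definition offset (u : nat) : nat := \sum_(0 <= v < u) deg v.

Record env (st : state) : Prop := Env {
  env_n : reg st 0 = n;
  env_gamma : reg st 1 = gamma;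
  env_s : reg st 2 = s;
  env_offset : forall u, u <= n -> arr st 0 u = offset u;
  env_nbr : forall u i, u < n -> i < deg u ->
    arr st 1 (offset u + i) = nth 0 (nbrs u) i }.

Lemma env_same R A st st' : env st -> same R A st st' ->
  ~~ has (mem [:: 0; 1; 2]) R -> ~~ has (mem [:: 0; 1]) A -> env st'.
Proof.
case=> en eg es eo eb [r a] /hasPn RP /hasPn AP.
have nR x : x \in [:: 0; 1; 2] -> x \notin R by apply: contraL => /RP.
have nA x : x \in [:: 0; 1] -> x \notin A by apply: contraL => /AP.
split; rewrite ?r ?nR //.
  by move=> u un; rewrite a ?nA ?eo.
by move=> u i un iu; rewrite a ?nA ?eb.
Qed.

Lemma deg_le u : deg u <= n.
Proof.
rewrite size_map -[leqRHS]card_ord; have [Uu _] := adjP (vtx s u).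
by rewrite -(card_uniqP Uu) max_card.
Qed.

Lemma offsetS u : offset u.+1 = offset u + deg u.
Proof. by rewrite /offset big_nat_recr. Qed.

Lemma offset_le u : u <= n -> offset u <= n * n.
Proof.
move=> un; apply: leq_trans (_ : u * n <= _); last by rewrite leq_mul2r un orbT.
elim: u un => [|u IH] un; first by rewrite /offset big_geq.
by rewrite offsetS mulSn addnC leq_add ?deg_le // IH // ltnW.
Qed.

Definition Adj (x u : nat) (c : cmd) : cmd :=
  For x (Get 0 (Var u)) (Get 0 (Op Add (Var u) (Cst 1))) c.

Lemma wp_adj (F : nat) (J : nat -> state -> Prop) x r u c st :
  env st -> reg st r = u -> u < n ->
  J 0 (set_reg st x (offset u)) ->
  (forall i st', J i st' -> env st' /\ reg st' r = u) ->
  (forall i st', i < deg u -> reg st' x = offset u + i -> J i st' ->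
     arr st' 1 (offset u + i) = nth 0 (nbrs u) i ->
     wp W c st' (fun t st1 => [/\ t <= F, reg st1 x = offset u + i &
       J i.+1 (set_reg st1 x (offset u + i.+1))])) ->
  wp W (Adj x r c) st (fun t st' => t <= deg u * (F + 11) + 10 /\ J (deg u) st').
Proof.
move=> E ru un J0 Je Jc.
have o1 := offset_le un; have oS := offsetS u.
apply: wp_conseq (wp_for_const (a := offset u) (b := offset u.+1) (F := F)
  (I := fun i st' => exists2 k, i = offset u + k & J k st') _ _ _ _ _ _ _ _) _.
- lia.
- lia.
- lia.
- by rewrite /= ru (env_offset E (ltnW un)); lia.
- by rewrite /= ru (env_offset E (ltnW un)).
- by exists 0; rewrite ?addn0.
- move=> i st' ai xi [k _ Jk]; have [E' ru'] := Je _ _ Jk.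
  by rewrite /= ru' addn1 (env_offset E' un); split=> //; split; [split|]; lia.
- move=> i st' ai xi [k ik Jk]; have [E' ru'] := Je _ _ Jk.
  have kd : k < deg u by lia.
  apply: wp_conseq (Jc k st' kd _ Jk _) _; [by rewrite xi| |].
    by rewrite (env_nbr E').
  move=> t st1 [tF x1 Jk']; split=> //; first by rewrite x1.
  by exists k.+1; rewrite ik ?addnS // -addnS.
move=> t st' [tT [k kE Jk]]; have -> : deg u = k by lia.
by move: tT => /=; rewrite oS addKn; have -> : deg u = k by lia.
Qed.

(** * Computing all distances *)

Definition all_pairs : cmd :=
  Seq (For 5 (Cst 0) (Var 0)
        (Seq (Put 2 (Op Add (Op Mul (Var 5) (Var 0)) (Var 5)) (Cst 1))
             (Put 3 (Var 5) (Op Add (Op Mul (Var 5) (Var 0)) (Var 5)))))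
 (Seq (Assign 6 (Var 0))
 (Seq (For 5 (Cst 0) (Op Mul (Var 0) (Var 0))
        (Seq (Assign 7 (Get 3 (Var 5)))
        (Seq (Assign 8 (Op Mod (Var 7) (Var 0)))
             (Adj 9 8
               (Seq (Assign 10 (Op Add (Op Defs.Sub (Var 7) (Var 8)) (Get 1 (Var 9))))
                    (If (Get 2 (Var 10)) Skip
                      (Seq (Put 2 (Var 10) (Op Add (Get 2 (Var 7)) (Cst 1)))
                      (Seq (Put 3 (Var 6) (Var 10))
                           (Assign 6 (Op Add (Var 6) (Cst 1)))))))))))
      (For 5 (Cst 0) (Op Mul (Var 0) (Var 0))
        (Put 2 (Var 5) (Op Defs.Sub (Get 2 (Var 5)) (Cst 1)))))).

Local Notation pair_dist := (pair_dist e s).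
Local Notation move_pair := (move_pair n).
Local Notation bfs := (bfs e adj s).

(** Array 2 holds distances plus one, so that the initial 0 means undiscovered; the last loop of
    [all_pairs] removes the shift. *)
Record queued (st : state) (q : seq nat) : Prop := Queued {
  queued_size : reg st 6 = size q;
  queued_nth : forall i, i < size q -> arr st 3 i = nth 0 q i;
  queued_dist : forall p, p < n * n ->
    arr st 2 p = if p \in q then (pair_dist p).+1 else 0 }.

(** The queue up to the head is unchanged, which lets the caller express the time spent as a sum
    over the processed pairs. *)
Lemma wp_bfs_scan h q st :
  env st -> bfs h q -> h < size q -> queued st q ->
  reg st 7 = nth 0 q h -> reg st 8 = nth 0 q h %% n ->
  wp W (Adj 9 8
               (Seq (Assign 10 (Op Add (Op Defs.Sub (Var 7) (Var 8)) (Get 1 (Var 9))))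
                    (If (Get 2 (Var 10)) Skip
                      (Seq (Put 2 (Var 10) (Op Add (Get 2 (Var 7)) (Cst 1)))
                      (Seq (Put 3 (Var 6) (Var 10))
                           (Assign 6 (Op Add (Var 6) (Cst 1))))))))
    st (fun t st' => t <= deg (nth 0 q h %% n) * 50 + 10 /\
      exists q', [/\ same [:: 6; 9; 10] [:: 2; 3] st st', queued st' q', bfs h.+1 q',
                     h < size q' & take h.+1 q' = take h.+1 q]).
Proof.
move=> E bq hq Q r7 r8; set p := nth 0 q h in r7 r8 *.
have pn : p < n * n by apply: (bfs_bound bq); apply: mem_nth.
pose J i st' := exists q', [/\ same [:: 6; 9; 10] [:: 2; 3] st st', queued st' q',
  bfs h q', h < size q' & take h.+1 q' = take h.+1 q /\
  forall w, w \in take i (nbrs (p %% n)) -> move_pair p w \in q'].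
have headE q' : h < size q' -> take h.+1 q' = take h.+1 q -> nth 0 q' h = p.
  by move=> _ tE; rewrite -(nth_take 0 (ltnSn h)) tE nth_take.
apply: wp_conseq (wp_adj (F := 39) (J := J) E r8 _ _ _ _) _.
- by rewrite ltn_mod.
- exists q; split=> //; first by same_tac.
    by case: Q => *; split.
  by split=> // w; rewrite take0.
- move=> i st' [q' [S _ _ _ _]]; split; first exact: (env_same E S).
  by read_state.
- move=> i st1 id x1 [q' [S Q' bq' hq' [tq' dn]]] nb1.
  have w_in : nth 0 (nbrs (p %% n)) i \in nbrs (p %% n) by apply: mem_nth.
  set w := nth 0 _ i in nb1 w_in; have wn := nbrs_lt w_in.
  have hE := headE _ hq' tq'.
  have mE : p - p %% n + w = move_pair p w by [].
  have mn : move_pair p w < n * n by apply: move_pair_lt.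
  have bs := bfs_size bq'.
  have dp : pair_dist p < n by apply: distn_lt.
  have pq' : p \in q' by rewrite -hE mem_nth.
  have oE := offset_le (ltn_pmod p n_gt0); have oS := offsetS (p %% n).
  have pm := ltn_pmod p n_gt0.
  apply: wp_seq; apply: wp_assign.
    rewrite /= x1 nb1; read_state; rewrite r7 r8 mE.
    by repeat split; lia.
  rewrite /= x1 nb1; read_state; rewrite r7 r8 mE.
  apply: wp_if => /=.
  - rewrite (queued_dist Q' mn); split; first lia.
    have := distn_lt s graph_e (move_pair p w %/ n) (move_pair p w %% n).
    by rewrite -/(pair_dist _); case: ifP => _; lia.
  - rewrite (queued_dist Q' mn) => dm; apply: wp_skip.
    have wq : move_pair p w \in q' by case: ifP dm.
    split; [lia|by rewrite /= x1|].
    exists q'; split=> //; first by same_tac.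
      by case: Q' => *; split.
    split=> // v; rewrite (take_nth 0) // mem_rcons inE => /predU1P[->|] //.
    exact: dn.
  rewrite (queued_dist Q' mn) => dm.
  have wq : move_pair p w \notin q' by case: ifP dm.
  have [||bq2 dq2] := bfs_discover graph_e adjP (w := w) bq' hq'; rewrite ?hE //.
  rewrite hE in bq2 dq2; have bs2 := bfs_size bq2; rewrite size_rcons in bs2.
  apply: wp_seq; apply: wp_put => /=.
  - by lia.
  - by read_state; rewrite r7 (queued_dist Q' pn) pq'; repeat split; lia.
  apply: wp_seq; apply: wp_put => /=.
  - by rewrite (queued_size Q'); lia.
  - by lia.
  apply: wp_assign => /=; first by rewrite (queued_size Q'); repeat split; lia.
  read_state; rewrite r7 (queued_dist Q' pn) pq' (queued_size Q') !addn1.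
  split; [lia|by rewrite /= x1|].
  exists (rcons q' (move_pair p w)); split=> //.
  - by same_tac.
  - split=> /=; first by rewrite size_rcons.
      move=> k; rewrite size_rcons ltnS nth_rcons leq_eqVlt; case: eqP => [->|_] /= kq.
        by rewrite ltnn.
      by rewrite kq (queued_nth Q').
    move=> r rn; rewrite mem_rcons inE; case: eqP => [->|_] /=; first by rewrite dq2.
    exact: queued_dist Q' _ rn.
  - by rewrite size_rcons ltnW.
  split; first by rewrite -cats1 takel_cat.
  move=> v; rewrite (take_nth 0) // !mem_rcons !inE => /predU1P[->|/dn ->].
    by rewrite eqxx.
  by rewrite orbT.
move=> t st' [tT [q' [S Q' bq' hq' [tq' dn]]]]; split; first by lia.
exists q'; split=> //; apply: bfs_advance => //; rewrite (headE _ hq' tq') => w wp.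
by apply: dn; rewrite take_size.
Qed.

Lemma wp_all_pairs st :
  env st -> (forall p, p < n * n -> arr st 2 p = 0) ->
  wp W all_pairs st (fun t st' => [/\ t <= 100 * (n * n + n * offset n) + 100,
    same [:: 5; 6; 7; 8; 9; 10] [:: 2; 3] st st' &
    forall u v, u < n -> v < n -> arr st' 2 (u * n + v) = distn u v]).
Proof.
move=> E a0; have nn : n <= n * n by rewrite leq_pmulr.
pose diag k := mkseq (fun u => u * n + u) k.
have diagS k : diag k.+1 = rcons (diag k) (k * n + k) by rewrite /diag mkseqS.
apply: wp_seq; apply: wp_conseq (wp_for_const (a := 0) (b := n) (F := 20)
  (I := fun k st' => [/\ same [:: 5] [:: 2; 3] st st',
     forall p, p < n * n -> arr st' 2 p = (p \in diag k) &
     forall i, i < k -> arr st' 3 i = i * n + i]) _ _ _ _ _ _ _ _) _; try lia.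
- by move=> /=; lia.
- by [].
- by split=> //; same_tac.
- move=> i st' _ _ [S _ _]; rewrite /=; read_state; rewrite (env_n E); split=> //; lia.
- move=> k st' /andP[_ kn] xk [S d2 d3].
  have kk := pair_lt kn kn.
  apply: wp_seq; apply: wp_put => /=; read_state; rewrite ?xk ?(env_n E).
  + by repeat split; lia.
  + by lia.
  apply: wp_put => /=; read_state; rewrite ?xk ?(env_n E); try (repeat split; lia).
  split; [lia|by []|split; first by same_tac].
    move=> p pn /=; rewrite diagS mem_rcons inE; case: eqP => //= _; exact: d2.
  move=> i ik /=; case: eqP => [->|] //= ik'; apply: d3; lia.
move=> t1 st1 [tT1 [S1 d2 d3]].
apply: wp_seq; apply: wp_assign; rewrite /=; read_state; rewrite (env_n E); first by lia.
pose bfs_cost p := 50 * deg (p %% n) + 30.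
apply: wp_seq; apply: wp_conseq (wp_for_acc (a := 0) (b := n * n)
  (I := fun h T st' => exists q,
     [/\ same [:: 5; 6; 7; 8; 9; 10] [:: 2; 3] st st', queued st' q, bfs h q &
     T <= \sum_(p <- take h q) bfs_cost p]) _ _ _ _ _ _ _ _) _; try lia.
- by move=> /=; lia.
- by [].
- exists (diag n); split; first by same_tac.
  + split=> /=; first by rewrite size_mkseq.
      by move=> i; rewrite size_mkseq => ni; rewrite nth_mkseq // d3.
    move=> p pn; rewrite d2 //; case: ifP => // /mapP[u]; rewrite mem_iota => un ->.
    by rewrite pair_distE divnMDl // modnMDl (divn_small un) (modn_small un) addn0 distnn.
  + exact: bfs_start.
  by [].
- move=> h T st' _ _ [q [S _ _ _]]; rewrite /=; read_state; rewrite (env_n E).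
  by repeat split; lia.
- move=> h T st' /andP[_ hn] xh [q [S Q bq tT]].
  have hq := bfs_progress graph_e adjP bq hn.
  have pq : nth 0 q h \in q by apply: mem_nth.
  have pn := bfs_bound bq pq.
  have hh := queued_nth Q hq.
  apply: wp_seq; apply: wp_assign; rewrite /= xh hh; first by split; lia.
  have pm := ltn_pmod (nth 0 q h) n_gt0.
  apply: wp_seq; apply: wp_assign; rewrite /=; read_state; rewrite (env_n E).
    by repeat split; lia.
  apply: wp_conseq (wp_bfs_scan (q := q) (h := h) _ bq hq _ _ _) _ => //.
  + apply: (env_same (R := [:: 5; 6; 7; 8; 9; 10]) (A := [:: 2; 3]) E) => //.
    by same_tac.
  + by case: Q => *; split.
  move=> t st2 [tT2 [q' [S2 Q' bq' hq' tE]]]; split.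
    by read_state.
  exists q'; split => //; [by same_tac|by case: Q' => *; split|].
  rewrite tE (take_nth 0) // -cats1 big_cat big_seq1 /= {2}/bfs_cost; lia.
move=> t2 st2 [T2 tT2 [q [S2 Q2 bq2 TT2]]].
have qfull := bfs_full graph_e adjP bq2.
(* Every pair is dequeued exactly once, so the degrees of the second components add up to
   [n * offset n]. *)
have qperm : perm_eq q (iota 0 (n * n)).
  apply: uniq_perm; [exact: bfs_uniq bq2|exact: iota_uniq|].
  move=> p; rewrite mem_iota; apply/idP/idP => [/(bfs_bound bq2)|/qfull] //.
have TT3 : T2 <= n * (50 * offset n + 30 * n).
  apply: leq_trans TT2 _; rewrite take_oversize; last exact: bfs_size bq2.
  rewrite (perm_big _ qperm) /= -[X in iota 0 X]subn0 -/(index_iota 0 (n * n)).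
  rewrite (sum_divn_modn n (fun _ v => 50 * deg v + 30) n_gt0) sum_nat_const_nat subn0.
  by rewrite big_split /= -big_distrr /= sum_nat_const_nat subn0 /offset mulnC; lia.
apply: wp_conseq (wp_for_const (a := 0) (b := n * n) (F := 7)
  (I := fun k st' => same [:: 5] [:: 2] st2 st' /\
     forall p, p < n * n -> arr st' 2 p = pair_dist p + (k <= p))
   _ _ _ _ _ _ _ _) _; try lia.
- by move=> /=; lia.
- by [].
- split; first by same_tac.
  by move=> p pn /=; rewrite (queued_dist Q2 pn) qfull // addn1.
- move=> i st' _ _ [S _]; rewrite /=; read_state; rewrite (env_n E).
  by repeat split; lia.
- move=> k st' /andP[_ kn] xk [S d].
  have dk := distn_lt s graph_e (k %/ n) (k %% n).
  apply: wp_put => /=; rewrite ?xk ?d //; try (repeat split; lia).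
    by rewrite -/(pair_dist k) in dk; rewrite leqnn; repeat split; lia.
  split=> //; split; first by same_tac.
  move=> p pn /=; case: eqP => [->|pk] /=; first by rewrite leqnn ltnn; lia.
  by rewrite d //; congr (_ + _); lia.
move=> t3 st3 [tT3 [S3 d]]; split.
- by move: tT1 tT2 tT3 TT3 => /=; rewrite !subn0; nia.
- by same_tac.
move=> u v un vn; rewrite d ?pair_lt // leqNgt pair_lt // addn0.
by rewrite pair_distE divnMDl // modnMDl (divn_small vn) (modn_small vn) addn0.
Qed.

(** * The number of codes and the code of the starting window *)

Definition powers : cmd :=
  Seq (Assign 3 (Cst 1))
      (For 5 (Cst 0) (Op Add (Var 1) (Cst 1))
        (Seq (Assign 3 (Op Mul (Var 3) (Var 0)))
             (Assign 4 (Op Add (Op Mul (Var 4) (Var 0)) (Var 2))))).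

Lemma expn_le_M i : i <= gamma.+1 -> n ^ i <= M.
Proof. by move=> ig; rewrite leq_pexp2l. Qed.

Lemma M_gt0 : 0 < M. Proof. by rewrite expn_gt0 n_gt0. Qed.
Lemma n_le_M : n <= M. Proof. by rewrite -{1}(expn1 n) expn_le_M. Qed.
Lemma M_le_nM : M <= n * M. Proof. by rewrite leq_pmull. Qed.

Lemma wp_powers st : env st -> reg st 4 = 0 ->
  wp W powers st (fun t st' => [/\ t <= 40 * gamma.+1 + 20,
    same [:: 3; 4; 5] [::] st st', reg st' 3 = M & reg st' 4 = repdigit n s gamma.+1]).
Proof.
move=> E r4; have := M_le_nM; have := M_gt0 => Mg MnM.
apply: wp_seq; apply: wp_assign; rewrite /=; first by lia.
apply: wp_conseq (wp_for_const (a := 0) (b := gamma.+1) (F := 20)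
  (I := fun k st' => [/\ same [:: 3; 4; 5] [::] st st', reg st' 3 = n ^ k &
     reg st' 4 = repdigit n s k]) _ _ _ _ _ _ _ _) _; try lia.
- by move=> /=; lia.
- by [].
- by split=> //; same_tac.
- move=> i st' _ _ [S _ _]; rewrite /=; read_state; rewrite (env_gamma E) addn1.
  by repeat split; lia.
- move=> k st' /andP[_ kg] xk [S r3 r4'].
  have le_k := expn_le_M (ltnW kg); have le_k1 := expn_le_M kg.
  have := @repdigit_lt n s k.+1 (ltn_ord s); rewrite /= -/(repdigit n s k) => rk.
  apply: wp_seq; apply: wp_assign => /=; read_state; rewrite (env_n E) r3 -expnSr.
    by repeat split; lia.
  apply: wp_assign => /=; read_state; rewrite (env_n E) (env_s E) r4'.
    by repeat split; nia.
  split; [by lia|by []|split=> //]; first by same_tac.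
by move=> t st' [tT [S r3 r4']]; split=> //; move: tT => /=; lia.
Qed.

Local Notation next := (shift_in n gamma).
Local Notation dist_descn := (dist_descn e s).
Local Notation childn := (childn e s).
Local Notation code_dist := (code_dist e s).

Record env_dp (st : state) : Prop := EnvDp {
  env_dp_env : env st;
  env_dp_M : reg st 3 = M;
  env_dp_start : reg st 4 = repdigit n s gamma.+1;
  env_dp_dist : forall u v, u < n -> v < n -> arr st 2 (u * n + v) = distn u v }.

Lemma env_dp_same R A st st' : env_dp st -> same R A st st' ->
  ~~ has (mem [:: 0; 1; 2; 3; 4]) R -> ~~ has (mem [:: 0; 1; 2]) A -> env_dp st'.
Proof.
case=> E rM rs dE S RP AP; have [r a] := S; move/hasPn: (RP) => RP'.
have nR x : x \in [:: 0; 1; 2; 3; 4] -> x \notin R by apply: contraL => /RP'.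
have A2 : 2 \notin A by apply/negP => A2; move/hasPn: AP => /(_ 2 A2).
split; rewrite ?r ?nR //.
  apply: (env_same E S); [apply: contra RP|apply: contra AP].
    by apply: sub_has => x /=; rewrite !inE => /or3P[] ->; rewrite ?orbT.
  by apply: sub_has => x /=; rewrite !inE => /orP[] ->; rewrite ?orbT.
by move=> u v un vn; rewrite a // dE.
Qed.

Lemma pair_eq a b x y : x < n -> y < n -> (a * n + x == b * n + y) = (a == b) && (x == y).
Proof.
move=> xn yn; apply/eqP/andP => [E|[/eqP-> /eqP->]] //.
have := congr1 (divn^~ n) E; have := congr1 (modn^~ n) E.
rewrite !modnMDl !(modn_small xn) !(modn_small yn) => ->.
by rewrite !divnMDl // !(divn_small yn) !addn0 => ->.
Qed.

Lemma code_dist_lt k c x : code_dist k c x < n.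
Proof.
elim: k => [|k IH] /=; first exact: distn_lt.
by rewrite gtn_min IH.
Qed.

(* Registers 5, 6 and 7 hold the step of the main loop, the window [c] and its
   last vertex. *)
Definition window_dists : cmd :=
  For 8 (Cst 0) (Var 0)
    (Seq (Assign 9 (Var 6))
    (Seq (Assign 10 (Get 2 (Op Add (Op Mul (Var 7) (Var 0)) (Var 8))))
    (Seq (Put 4 (Op Add (Op Mul (Var 6) (Var 0)) (Var 8)) (Var 10))
    (Seq (For 11 (Cst 0) (Op Add (Var 1) (Cst 1))
           (Seq (If (Op Lt (Get 2 (Op Add (Op Mul (Op Mod (Var 9) (Var 0)) (Var 0)) (Var 8)))
                           (Var 10))
                    (Assign 10 (Get 2 (Op Add (Op Mul (Op Mod (Var 9) (Var 0)) (Var 0)) (Var 8))))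
                    Skip)
                (Assign 9 (Op Div (Var 9) (Var 0)))))
         (Put 7 (Var 8) (Var 10)))))).

Lemma wp_window_dists c st :
  env_dp st -> c < M -> reg st 6 = c -> reg st 7 = c %% n ->
  wp W window_dists st (fun t st' => [/\ t <= n * (50 * gamma.+1 + 60) + 20,
    same [:: 8; 9; 10; 11] [:: 4; 7] st st',
    forall x, x < n -> arr st' 7 x = code_dist gamma.+1 c x,
    forall x, x < n -> arr st' 4 (c * n + x) = distn (c %% n) x &
    forall b x, b != c -> x < n -> arr st' 4 (b * n + x) = arr st 4 (b * n + x)]).
Proof.
move=> D cM r6 r7; have E := env_dp_env D; have MnM := M_le_nM; have nM := n_le_M.
apply: wp_conseq (wp_for_const (a := 0) (b := n) (F := 50 * gamma.+1 + 50)
  (I := fun k st' => [/\ same [:: 8; 9; 10; 11] [:: 4; 7] st st',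
    forall x, x < k -> arr st' 7 x = code_dist gamma.+1 c x,
    forall x, x < k -> arr st' 4 (c * n + x) = distn (c %% n) x &
    forall b x, b != c -> x < n -> arr st' 4 (b * n + x) = arr st 4 (b * n + x)])
  _ _ _ _ _ _ _ _) _; try lia.
- by move=> /=; lia.
- by [].
- by split=> //; same_tac.
- move=> i st' _ _ [S _ _ _]; rewrite /=; read_state; rewrite (env_n E); split=> //; lia.
- move=> x st' /andP[_ xn] xx [S d7 d4 d4'].
  have cm := ltn_pmod c n_gt0.
  have p1 := pair_lt cM xn; rewrite [M * n]mulnC in p1.
  have p2 := pair_lt cm xn.
  have dn1 := distn_lt s graph_e (c %% n) x.
  apply: wp_seq; apply: wp_assign => /=; read_state; rewrite r6; first by lia.
  apply: wp_seq; apply: wp_assign => /=; rewrite xx; read_state;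
    rewrite r7 (env_n E) (env_dp_dist D cm xn).
    by repeat split; lia.
  apply: wp_seq; apply: wp_put => /=; rewrite ?xx; read_state;
    rewrite ?r6 ?(env_n E); try (repeat split; lia).
  set st1 := set_arr _ _ _ _.
  have S1 : same [:: 8; 9; 10; 11] [:: 4; 7] st st1 by rewrite /st1; same_tac.
  have r8' : reg st1 8 = x by [].
  apply: wp_seq; apply: wp_conseq (wp_for_const (a := 0) (b := gamma.+1) (F := 34)
   (I := fun k st' => [/\ same [:: 9; 10; 11] [::] st1 st', reg st' 9 = c %/ n ^ k &
      reg st' 10 = code_dist k c x]) _ _ _ _ _ _ _ _) _; try lia.
  + by move=> /=; lia.
  + by [].
  + by split=> //; [same_tac|rewrite /= expn0 divn1].
  + move=> k st2 _ _ [S2 _ _]; rewrite /=; read_state.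
    by rewrite (env_gamma E) addn1; repeat split; lia.
  + move=> k st2 /andP[_ kg] xk [S2 r9 r10].
    have r8 : reg st2 8 = x by read_state; rewrite /= xx.
    have dm := ltn_pmod (c %/ n ^ k) n_gt0.
    have p3 := pair_lt dm xn.
    have dn2 := distn_lt s graph_e (digit n c k) x.
    have dn3 := code_dist_lt k c x.
    have ck : c %/ n ^ k <= c by apply: leq_div.
    have dE : distn ((c %/ n ^ k) %% n) x = distn (digit n c k) x by [].
    have ck1 : c %/ n ^ k %/ n <= c by apply: leq_trans ck; apply: leq_div.
    apply: wp_seq; apply: wp_if => /=.
    * rewrite r8; read_state; rewrite r9 (env_n E) r10 (env_dp_dist D dm xn) dE.
      by repeat split; try lia; case: leqP; lia.
    * rewrite r8; read_state; rewrite r9 (env_n E) r10 (env_dp_dist D dm xn) dE => lt_d.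
      apply: wp_assign => /=.
        rewrite r8; read_state; rewrite r9 (env_n E) (env_dp_dist D dm xn) dE.
        by repeat split; lia.
      apply: wp_assign => /=; read_state; rewrite r9 (env_n E).
        by repeat split; lia.
      rewrite r8' (env_dp_dist D dm xn) dE.
      split; [by lia|by rewrite xk|split; first by same_tac].
        by rewrite /= expnSr divnMA.
      by rewrite /=; symmetry; apply/minn_idPr; move: lt_d; case: ltnP => // /ltnW.
    rewrite r8; read_state; rewrite r9 (env_n E) r10 (env_dp_dist D dm xn) dE => lt_d.
    apply: wp_skip; apply: wp_assign => /=; read_state; rewrite r9 (env_n E).
      by repeat split; lia.
    split; [by lia|by rewrite xk|split; first by same_tac].
      by rewrite /= expnSr divnMA.
    by rewrite /= r10; symmetry; apply/minn_idPl; move: lt_d; case: ltnP.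
  move=> t1 st2 [tT1 [S2 r9 r10]].
  have r8 : reg st2 8 = x by read_state; rewrite /= xx.
  have dn3 := code_dist_lt gamma.+1 c x.
  apply: wp_put => /=; rewrite ?r8 ?r10; try lia.
  split; [by move: tT1 => /=; lia|by []|split].
  + by same_tac.
  + move=> y; rewrite ltnS leq_eqVlt /=; case: eqP => [->|_] //= yx.
    by read_state; rewrite /= d7.
  + move=> y; rewrite ltnS leq_eqVlt /=; read_state; rewrite /=.
    case: eqP => [->|yx] /=; first by rewrite eqxx.
    by rewrite eqn_add2l => yx'; rewrite (introF eqP yx) d4.
  move=> b y bc yn; rewrite /=; read_state; rewrite /= pair_eq // (negPf bc) /=.
  exact: d4'.
move=> t st' [tT [S d7 d4 d4']]; split=> //; by move: tT => /=; lia.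
Qed.

(** * Successor windows and distances to descendants *)

Definition is_child : expr :=
  Op Eq (Get 2 (Op Add (Op Mul (Var 2) (Var 0)) (Var 9)))
        (Op Add (Get 2 (Op Add (Op Mul (Var 2) (Var 0)) (Var 7))) (Cst 1)).

Definition shifted : expr :=
  Op Mod (Op Add (Op Mul (Var 6) (Var 0)) (Var 9)) (Var 3).

Lemma is_childE c v st : env_dp st -> reg st 7 = c %% n -> reg st 9 = v -> v < n ->
  fits W st is_child /\ den st is_child = childn (c %% n) v.
Proof.
move=> D r7 r9 vn; have E := env_dp_env D; have sn := ltn_ord s.
have cm := ltn_pmod c n_gt0; have nn : n <= n * n by rewrite leq_pmulr.
have p1 := pair_lt sn vn; have p2 := pair_lt sn cm.
have dv := distn_lt s graph_e s v; have du := distn_lt s graph_e s (c %% n).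
rewrite /= (env_s E) (env_n E) r7 r9 !(env_dp_dist D) // addn1; split=> //.
by repeat split; try lia; case: eqP; lia.
Qed.

Lemma shiftedE c v st : env_dp st -> c < M -> reg st 6 = c -> reg st 9 = v -> v < n ->
  fits W st shifted /\ den st shifted = next c v.
Proof.
move=> D cM r6 r9 vn; have E := env_dp_env D.
have MnM := M_le_nM; have nM := n_le_M.
have p1 := pair_lt cM vn; rewrite [M * n]mulnC in p1.
have lt := shift_in_lt gamma c v n_gt0; rewrite /shift_in in lt.
by rewrite /= (env_n E) r6 r9 (env_dp_M D); split=> //; repeat split; lia.
Qed.

Definition child_dists (l : seq nat) (u x : nat) : nat :=
  foldl (fun b v => if childn u v then minn b (dist_descn v x) else b) (distn u x) l.

Lemma child_dists_rcons l v u x : child_dists (rcons l v) u x =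
  if childn u v then minn (child_dists l u x) (dist_descn v x) else child_dists l u x.
Proof. by rewrite /child_dists -cats1 foldl_cat. Qed.

(** No term is too small by [dist_desc_child]; by [descendant_split] a nearest descendant is [u]
    itself or descends from a child in the list. *)
Lemma child_distsE u x : u < n -> child_dists (nbrs u) u x = dist_descn u x.
Proof.
move=> un; apply/eqP; rewrite eqn_leq; apply/andP; split; last first.
  have base : dist_descn u x <= distn u x by apply/dist_desc_leq/descendantxx.
  have : forall v, v \in nbrs u -> childn u v -> dist_descn u x <= dist_descn v x.
    move=> v vu uv; apply: (dist_desc_child graph_e).
    by rewrite (child_nbrs _ adjP) !vtxK ?(nbrs_lt vu) // vu uv.
  rewrite /child_dists; move: (distn u x) base.
  elim: (nbrs u) => //= v l IH b ub H; apply: IH => [|w wl]; last first.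
    by apply: H; rewrite inE wl orbT.
  by case: ifP => // uv; rewrite leq_min ub H ?mem_head.
have low b l : foldl (fun b v => if childn u v then minn b (dist_descn v x) else b) b l <= b.
  elim: l b => //= v l IH b; apply: leq_trans (IH _) _.
  by case: ifP => // _; apply: geq_minl.
have lowv b l v : v \in l -> childn u v ->
    foldl (fun b v => if childn u v then minn b (dist_descn v x) else b) b l <= dist_descn v x.
  move=> + uv; elim: l b => //= w l IH b; rewrite inE => /predU1P[<-|]; last exact: IH.
  by apply: leq_trans (low _ _) _; rewrite uv geq_minr.
rewrite dist_descnE; have [y uy ->] := dist_descE graph_e s (vtx s u) (vtx s x).
case: (descendant_split graph_e uy) => [->|[v uv vy]]; first exact: low.
move: uv; rewrite (child_nbrs _ adjP) vtxK // => /andP[vu uv].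
apply: leq_trans (lowv _ _ _ vu uv) _; rewrite dist_descnE vtx_val.
exact: dist_desc_leq.
Qed.

(** These distances depend only on the last vertex of the window, but each window keeps its own row
    of array 4. The rows of successors are ready when needed, and a row costs no more, up to a
    constant, than the charges. *)
Definition descend : cmd :=
  Adj 8 7
    (Seq (Assign 9 (Get 1 (Var 8)))
         (If is_child
            (Seq (Assign 10 shifted)
                 (For 11 (Cst 0) (Var 0)
                    (If (Op Lt (Get 4 (Op Add (Op Mul (Var 10) (Var 0)) (Var 11)))
                               (Get 4 (Op Add (Op Mul (Var 6) (Var 0)) (Var 11))))
                        (Put 4 (Op Add (Op Mul (Var 6) (Var 0)) (Var 11))
                               (Get 4 (Op Add (Op Mul (Var 10) (Var 0)) (Var 11))))
                        Skip)))
            Skip)).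

Lemma dist_descn_lt u x : dist_descn u x < n.
Proof.
apply: leq_ltn_trans (distn_lt s graph_e u x).
exact/dist_desc_leq/descendantxx.
Qed.

Lemma wp_descend c st :
  env_dp st -> c < M -> reg st 6 = c -> reg st 7 = c %% n ->
  (forall x, x < n -> arr st 4 (c * n + x) = distn (c %% n) x) ->
  (forall v x, v \in nbrs (c %% n) -> childn (c %% n) v -> x < n ->
     next c v != c /\ arr st 4 (next c v * n + x) = dist_descn v x) ->
  wp W descend st (fun t st' => [/\ t <= deg (c %% n) * (40 * n + 60) + 10,
    same [:: 8; 9; 10; 11] [:: 4] st st',
    forall x, x < n -> arr st' 4 (c * n + x) = dist_descn (c %% n) x &
    forall b x, b != c -> x < n -> arr st' 4 (b * n + x) = arr st 4 (b * n + x)]).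
Proof.
move=> D cM r6 r7 d4 ch; have E := env_dp_env D; have MnM := M_le_nM; have nM := n_le_M.
have cm := ltn_pmod c n_gt0.
have cd_lt l x : child_dists l (c %% n) x < n.
  rewrite /child_dists; have := distn_lt s graph_e (c %% n) x.
  elim: l (distn _ x) => //= v l IH b bn; apply: IH; case: ifP => // _.
  by rewrite gtn_min bn.
apply: wp_conseq (wp_adj (F := 40 * n + 45) (J := fun i st' =>
   [/\ same [:: 8; 9; 10; 11] [:: 4] st st',
    forall x, x < n -> arr st' 4 (c * n + x) = child_dists (take i (nbrs (c %% n))) (c %% n) x &
    forall b x, b != c -> x < n -> arr st' 4 (b * n + x) = arr st 4 (b * n + x)])
    E r7 cm _ _ _) _.
- split=> //; first by same_tac.
  by move=> x xn; rewrite take0 /= d4.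
- move=> i st' [S _ _]; split; first exact: (env_same E S).
  by read_state.
- move=> i st1 id x1 [S d4' d4''] nb1.
  have v_in : nth 0 (nbrs (c %% n)) i \in nbrs (c %% n) by apply: mem_nth.
  have tE x : child_dists (take i.+1 (nbrs (c %% n))) (c %% n) x =
      if childn (c %% n) (nth 0 (nbrs (c %% n)) i)
      then minn (child_dists (take i (nbrs (c %% n))) (c %% n) x)
             (dist_descn (nth 0 (nbrs (c %% n)) i) x)
      else child_dists (take i (nbrs (c %% n))) (c %% n) x.
    by rewrite (take_nth 0) // child_dists_rcons.
  have oE := offset_le cm; have oS := offsetS (c %% n).
  set v := nth 0 _ i in nb1 v_in tE; have vn := nbrs_lt v_in.
  apply: wp_seq; apply: wp_assign; rewrite /= x1 nb1; first by split; lia.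
  set st2 := set_reg _ _ _.
  have S2 : same [:: 8; 9; 10; 11] [:: 4] st st2 by rewrite /st2; same_tac.
  have D2 : env_dp st2 by apply: (env_dp_same D S2).
  have r72 : reg st2 7 = c %% n by read_state.
  have [fc dc] := is_childE D2 r72 (erefl v : reg st2 9 = v) vn.
  apply: wp_if; rewrite ?dc //; last first.
    move=> nc; apply: wp_skip; split; [by rewrite /=; lia|by rewrite /= x1|].
    have {}nc : childn (c %% n) v = false by case: childn nc.
    split; [by same_tac| |exact: d4''].
    by move=> x xn; rewrite tE nc /= d4'.
  rewrite eqb0 negbK => uv; have nc x xn := proj1 (ch v x v_in uv xn).
  have {}nc := nc 0 n_gt0.
  have r62 : reg st2 6 = c by read_state.
  have [fs ds] := shiftedE D2 cM r62 (erefl v : reg st2 9 = v) vn.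
  apply: wp_seq; apply: wp_assign; rewrite ?ds //.
  set st3 := set_reg st2 _ _.
  have S3 : same [:: 8; 9; 10; 11] [:: 4] st st3 by rewrite /st3; same_tac.
  have nM' := shift_in_lt gamma c v n_gt0.
  apply: wp_conseq (wp_for_const (a := 0) (b := n) (F := 26) (I := fun k st' =>
     [/\ same [:: 11] [:: 4] st3 st',
         forall x, x < n -> arr st' 4 (c * n + x) =
           child_dists (take (if x < k then i.+1 else i) (nbrs (c %% n))) (c %% n) x &
         forall b x, b != c -> x < n -> arr st' 4 (b * n + x) = arr st 4 (b * n + x)])
      _ _ _ _ _ _ _ _) _; try lia.
  + by move=> /=; lia.
  + by [].
  + by split=> //; same_tac.
  + move=> k st' _ _ [S' _ _]; rewrite /=; read_state; rewrite (env_n E); split=> //; lia.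
  + move=> x st' /andP[_ xn] xx [S' a4 a4'].
    have r10 : reg st' 10 = next c v by read_state.
    have p1 := pair_lt cM xn; rewrite [M * n]mulnC in p1.
    have p2 := pair_lt nM' xn; rewrite [M * n]mulnC in p2.
    have dd := dist_descn_lt v x; have dcd := cd_lt (take i (nbrs (c %% n))) x.
    have a4n : arr st' 4 (next c v * n + x) = dist_descn v x.
      by rewrite a4' //; have [_ ->] := ch v x v_in uv xn.
    have a4c : arr st' 4 (c * n + x) = child_dists (take i (nbrs (c %% n))) (c %% n) x.
      by rewrite a4 // ltnn.
    have upd (a : nat -> nat) : (forall y, y < n -> y != x ->
          a (c * n + y) = arr st' 4 (c * n + y)) ->
        a (c * n + x) = child_dists (take i.+1 (nbrs (c %% n))) (c %% n) x ->
        forall y, y < n -> a (c * n + y) =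
           child_dists (take (if y < x.+1 then i.+1 else i) (nbrs (c %% n))) (c %% n) y.
      move=> oth xE y yn; rewrite ltnS leq_eqVlt; case: eqP => [->|/eqP yx] //=.
      by rewrite oth // a4.
    apply: wp_if => /=; rewrite r10 xx; read_state; rewrite r6 (env_n E) a4n a4c.
    * by repeat split; try lia; case: leqP; lia.
    * rewrite eqb0 negbK => lt_d.
      apply: wp_put => /=; rewrite ?r10 ?xx; read_state; rewrite ?r6 ?(env_n E) ?a4n;
        try (repeat split; lia).
      split; [by lia|by []|split; first by same_tac].
        apply: (upd (arr (set_arr st' 4 (c * n + x) (dist_descn v x)) 4)); rewrite /= ?eqxx.
          by move=> y yn yx; rewrite eqn_add2l (negPf yx).
        by rewrite tE uv (minn_idPr (ltnW lt_d)).
      by move=> b y bc yn; rewrite /= pair_eq // (negPf bc) /=; apply: a4'.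
    move=> /eqP; rewrite eqb0 -leqNgt => lt_d; apply: wp_skip.
    split; [by lia|by []|split; first by same_tac].
      by apply: (upd (arr st' 4)) => //=; rewrite tE uv (minn_idPl lt_d).
    exact: a4'.
  move=> t st' [tT [S' a4 a4']]; split.
  + by move: tT => /=; lia.
  + by read_state; rewrite /= x1.
  split; [by same_tac| |exact: a4'].
  by move=> x xn; rewrite a4 // xn.
move=> t st' [tT [S d4' d4'']]; split=> //; first by lia.
by move=> x xn; rewrite d4' // take_size child_distsE.
Qed.

(** * Charges and the choice of an optimal child *)

Local Notation code_charge := (code_charge e gamma s).
Local Notation code_charge_at := (code_charge_at e gamma s).
Local Notation dp_eqn := (dp_eqn e gamma s).

(* Register 12 is [maxn (G (next c v)) (code_charge c v)] for the child [v] in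
   register 9. *)
Definition choose_child : cmd :=
  Seq (Put 5 (Var 6) (Cst 0))
 (Seq (Put 6 (Var 6) (Cst 0))
  (Adj 8 7
    (Seq (Assign 9 (Get 1 (Var 8)))
         (If is_child
            (Seq (Assign 10 shifted)
            (Seq (Assign 12 (Get 5 (Var 10)))
            (Seq (For 11 (Cst 0) (Var 0)
                    (Seq (Assign 13 (Get 7 (Var 11)))
                    (Seq (Assign 14 (Get 2 (Op Add (Op Mul (Var 9) (Var 0)) (Var 11))))
                    (Seq (If (Op Lt (Var 13) (Var 14)) (Assign 14 (Var 13)) Skip)
                         (If (Op Mul
                               (Op Lt (Get 4 (Op Add (Op Mul (Var 6) (Var 0)) (Var 11))) (Var 13))
                               (Op Mul
                                 (Op Lt (Var 14)
                                    (Op Add (Get 4 (Op Add (Op Mul (Var 10) (Var 0)) (Var 11)))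
                                            (Cst 1)))
                                 (Op Lt (Var 12) (Var 14))))
                             (Assign 12 (Var 14)) Skip)))))
                 (If (Op Add (Op Eq (Get 6 (Var 6)) (Cst 0)) (Op Lt (Var 12) (Get 5 (Var 6))))
                     (Seq (Put 5 (Var 6) (Var 12))
                          (Put 6 (Var 6) (Op Add (Var 9) (Cst 1))))
                     Skip))))
            Skip)))).

Lemma code_charge_at_lt c v x : code_charge_at c v x < n.
Proof.
rewrite code_charge_atE; case: ifP => _; last exact: n_gt0.
by rewrite gtn_min code_dist_lt.
Qed.

Lemma wp_choose_child c st :
  env_dp st -> c < M -> reg st 6 = c -> reg st 7 = c %% n ->
  (forall x, x < n -> arr st 7 x = code_dist gamma.+1 c x) ->
  (forall x, x < n -> arr st 4 (c * n + x) = dist_descn (c %% n) x) ->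
  (forall v, v \in nbrs (c %% n) -> childn (c %% n) v ->
     [/\ next c v != c, arr st 5 (next c v) < n &
         forall x, x < n -> arr st 4 (next c v * n + x) = dist_descn v x]) ->
  wp W choose_child st (fun t st' => [/\ t <= deg (c %% n) * (90 * n + 100) + 30,
    same [:: 8; 9; 10; 11; 12; 13; 14] [:: 5; 6] st st',
    dp_eqn (nbrs (c %% n)) (arr st' 5) (arr st' 6) c, arr st' 5 c < n &
    forall b, b != c -> arr st' 5 b = arr st 5 b /\ arr st' 6 b = arr st 6 b]).
Proof.
move=> D cM r6 r7 a7 a4 ch; have E := env_dp_env D; have MnM := M_le_nM; have nM := n_le_M.
have cm := ltn_pmod c n_gt0.
apply: wp_seq; apply: wp_put => /=; rewrite ?r6; try lia.
apply: wp_seq; apply: wp_put => /=; rewrite ?r6; try lia.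
set st0 := set_arr _ _ _ _.
have S0 : same [:: 8; 9; 10; 11; 12; 13; 14] [:: 5; 6] st st0 by rewrite /st0; same_tac.
have D0 : env_dp st0 by case: (D) => -[*]; split=> //; split.
have E0 := env_dp_env D0.
apply: wp_conseq (wp_adj (F := 90 * n + 85) (J := fun i st' =>
   [/\ same [:: 8; 9; 10; 11; 12; 13; 14] [:: 5; 6] st0 st',
    dp_eqn (take i (nbrs (c %% n))) (arr st' 5) (arr st' 6) c, arr st' 5 c < n,
    arr st' 6 c <= n &
    forall b, b != c -> arr st' 5 b = arr st 5 b /\ arr st' 6 b = arr st 6 b])
    E0 r7 cm _ _ _) _.
- split=> //; first by same_tac.
  + by left; split; rewrite /= ?eqxx ?take0.
  + by rewrite /= eqxx.
  + by rewrite /= eqxx.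
  by move=> b bc; rewrite /= (negPf bc).
- move=> i st' [S _ _ _ _]; split; first exact: (env_same E0 S).
  by read_state.
- move=> i st1 id x1 [S eqn g5 g6 oth] nb1.
  have v_in : nth 0 (nbrs (c %% n)) i \in nbrs (c %% n) by apply: mem_nth.
  have tE : take i.+1 (nbrs (c %% n)) =
      rcons (take i (nbrs (c %% n))) (nth 0 (nbrs (c %% n)) i) by apply: take_nth.
  have oE := offset_le cm; have oS := offsetS (c %% n).
  set v := nth 0 _ i in nb1 v_in tE; have vn := nbrs_lt v_in.
  apply: wp_seq; apply: wp_assign; rewrite /= x1 nb1; first by split; lia.
  set st2 := set_reg _ _ _.
  have S2 : same [:: 8; 9; 10; 11; 12; 13; 14] [:: 5; 6] st st2 by rewrite /st2; same_tac.
  have D2 : env_dp st2 by apply: (env_dp_same D S2).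
  have r72 : reg st2 7 = c %% n by read_state.
  have [fc dc] := is_childE D2 r72 (erefl v : reg st2 9 = v) vn.
  apply: wp_if; rewrite ?dc //; last first.
    move=> nc; apply: wp_skip; split; [by rewrite /=; lia|by rewrite /= x1|].
    have {}nc : childn (c %% n) v = false by case: childn nc.
    split=> //; first by same_tac.
    rewrite tE; case: eqn => [[nx0 G0 l0]|[w [wl wc nxE GE Gmin]]]; [left|right].
      by split=> // w; rewrite mem_rcons inE => /predU1P[->|/l0]; rewrite ?nc.
    exists w; split=> //; first by rewrite mem_rcons inE wl orbT.
    by move=> y; rewrite mem_rcons inE => /predU1P[->|]; [rewrite nc|exact: Gmin].
  rewrite eqb0 negbK => uv; have [nc gn d4n] := ch v v_in uv.
  have r62 : reg st2 6 = c by read_state.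
  have [fs ds] := shiftedE D2 cM r62 (erefl v : reg st2 9 = v) vn.
  apply: wp_seq; apply: wp_assign; rewrite ?ds //.
  have nM' := shift_in_lt gamma c v n_gt0.
  have g5n : arr st1 5 (next c v) = arr st 5 (next c v) by have [] := oth _ nc.
  apply: wp_seq; apply: wp_assign; rewrite /= g5n; first by split; lia.
  set st3 := set_reg _ 12 _.
  have S3 : same [:: 8; 9; 10; 11; 12; 13; 14] [:: 5; 6] st st3 by rewrite /st3; same_tac.
  have g5c : arr st3 5 c < n by [].
  have g6c : arr st3 6 c <= n by [].
  (* Starts from the optimum of the successor window and takes in one charge at a time; at [k = n]
     it is the candidate value in [dp_eqn]. *)
  pose best k := maxn (arr st 5 (next c v)) (\max_(0 <= x < k) code_charge_at c v x).
  have best_lt k : best k < n.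
    rewrite gtn_max gn big_mkord /=; elim/big_ind: _ => //.
      by move=> x y; rewrite gtn_max => -> ->.
    by move=> x _; apply: code_charge_at_lt.
  have bestS k : best k.+1 = maxn (best k) (code_charge_at c v k).
    by rewrite /best big_nat_recr //= maxnA.
  apply: wp_seq; apply: wp_conseq (wp_for_const (a := 0) (b := n) (F := 60)
      (I := fun k st' => same [:: 11; 12; 13; 14] [::] st3 st' /\ reg st' 12 = best k)
      _ _ _ _ _ _ _ _) _; try lia.
  + by move=> /=; lia.
  + by [].
  + by split; [same_tac|rewrite /best big_geq // maxn0].
  + move=> k st' _ _ [S' _]; rewrite /=; read_state; rewrite (env_n E); split=> //; lia.
  + move=> x st' /andP[_ xn] xx [S' r12].
    have p1 := pair_lt cM xn; rewrite [M * n]mulnC in p1.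
    have p2 := pair_lt nM' xn; rewrite [M * n]mulnC in p2.
    have p3 := pair_lt vn xn.
    have l1 := dist_descn_lt v x; have l2 := dist_descn_lt (c %% n) x.
    have l3 := code_dist_lt gamma.+1 c x; have l4 := distn_lt s graph_e v x.
    have l5 := best_lt x.
    have r10 : reg st' 10 = next c v by read_state.
    have r9 : reg st' 9 = v by read_state.
    have r6' : reg st' 6 = c by read_state.
    have b7 : arr st' 7 x = code_dist gamma.+1 c x by read_state; apply: a7.
    have b2 : arr st' 2 (v * n + x) = distn v x by read_state; apply: (env_dp_dist D).
    have b4 : arr st' 4 (c * n + x) = dist_descn (c %% n) x by read_state; apply: a4.
    have b4' : arr st' 4 (next c v * n + x) = dist_descn v x by read_state; apply: d4n.
    have r0 : reg st' 0 = n by read_state; exact: env_n E.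
    have chE := bestS x; rewrite code_charge_atE in chE; cbv zeta in chE.
    set a := code_dist _ _ _ in l3 b7 chE; set dv := distn v x in l4 b2 chE.
    have m1 : minn a dv < n by rewrite gtn_min l3.
    apply: wp_seq; apply: wp_assign; rewrite /= xx b7; first by split; lia.
    apply: wp_seq; apply: wp_assign; rewrite /= xx r9 r0 b2; first by repeat split; lia.
    apply: wp_seq.
    apply: (wp_conseq (Q := fun t st4 => t <= 6 /\
      same [:: 13; 14] [::] st' st4 /\ reg st4 13 = a /\ reg st4 14 = minn a dv)).
      apply: wp_if => /=; first by repeat split; try lia; case: leqP; lia.
        rewrite eqb0 negbK => lt_a; apply: wp_assign => /=; first by lia.
        split; [by []|split; first by same_tac].
        by rewrite (minn_idPl (ltnW lt_a)).
      move=> /eqP; rewrite eqb0 -leqNgt => lt_a; apply: wp_skip.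
      split; [by []|split; first by same_tac].
      by rewrite (minn_idPr lt_a).
    move=> t4 st4 [tT4 [S4 [r13 r14]]].
    rewrite -(same_reg S4 (x := 0) isT) in r0; rewrite -(same_reg S4 (x := 6) isT) in r6'.
    rewrite -(same_reg S4 (x := 10) isT) in r10; rewrite -(same_reg S4 (x := 11) isT) in xx.
    rewrite -(same_reg S4 (x := 12) isT) in r12; rewrite -(same_arr _ S4 (a := 4) isT) in b4.
    rewrite -(same_arr _ S4 (a := 4) isT) in b4'.
    apply: wp_if => /=; rewrite ?r13 ?r14 ?xx ?r6' ?r0 ?r10 ?r12 ?b4 ?b4'.
    * have bW (p q r : bool) : p * (q * r) < W.
        by case: p q r => [] [] []; rewrite ?muln0 ?muln1; lia.
      repeat split; first [lia|exact: bW|by rewrite -[_ * _]mul1n (bW true)].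
    * rewrite !muln_eq0 !negb_or !eqb0 !negbK addn1 ltnS => /and3P[c1 c2 c3].
      apply: wp_assign => /=; rewrite r14; first by lia.
      split; [by lia|by []|split; first by same_tac].
      rewrite /= chE; case: ifP => [_|/negP[]]; last by apply/andP; split.
      by rewrite (maxn_idPr (ltnW c3)).
    rewrite addn1 ltnS => /eqP; rewrite !muln_eq0 !eqb0 => c123.
    apply: wp_skip; split; [by lia|by []|split; first by same_tac].
    rewrite /= r12 chE; case: ifP => [/andP[c1 c2]|_]; last first.
      by rewrite maxn0.
    by case/or3P: c123 => [/negP[]|/negP[]|] //; rewrite -leqNgt => /maxn_idPl ->.
  move=> t4 st4 [tT4 [S4 r12]].
  have optE : best n = maxn (code_charge c v) (arr st 5 (next c v)) by rewrite maxnC.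
  rewrite optE in r12.
  have lbest := best_lt n; rewrite optE in lbest.
  have r64 : reg st4 6 = c by read_state.
  have r94 : reg st4 9 = v by read_state.
  have e6 j : arr st4 6 j = arr st1 6 j by read_state.
  have e5 j : arr st4 5 j = arr st1 5 j by read_state.
  apply: wp_if => /=; rewrite r64 r12 e6 e5.
  + by repeat split; try lia; case: eqP; case: leqP; lia.
  + move=> better.
    apply: wp_seq; apply: wp_put => /=; rewrite ?r64 ?r12; try lia.
    apply: wp_put => /=; rewrite ?r64 ?r94; try (repeat split; lia).
    split; [by move: tT4 => /=; lia|by rewrite /=; read_state; rewrite /= x1|split].
    * by same_tac.
    * right; exists v; rewrite /= !eqxx (negPf nc) /= addn1 e5 g5n.
      rewrite tE mem_rcons mem_head; split=> //.
      move=> w; rewrite mem_rcons inE => /predU1P[->|wl] wc.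
        by rewrite (negPf nc) e5 g5n.
      have w_in : w \in nbrs (c %% n) by apply: mem_take wl.
      have [nw _ _] := ch w w_in wc; rewrite (negPf nw) e5.
      move: better; case: eqn => [[_ _ /(_ w wl)]|[y [_ _ nxE _ /(_ w wl wc)]]].
        by rewrite wc.
      rewrite nxE /= add0n eqb0 negbK => Gle lt_b.
      exact: leq_trans (ltnW lt_b) Gle.
    * by rewrite /= eqxx.
    * by rewrite /= eqxx addn1.
    by move=> b bc; rewrite /= (negPf bc) /= e5 e6; apply: oth.
  move=> /eqP; rewrite addn_eq0 !eqb0 -leqNgt => /andP[nx0 Gle]; apply: wp_skip.
  split; [by move: tT4 => /=; lia|by read_state; rewrite /= x1|split].
  + by same_tac.
  + case: eqn => [[nxE]|[w [wl wc nxE GE Gmin]]]; first by rewrite nxE in nx0.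
    right; exists w; rewrite /=; split.
    * by rewrite tE mem_rcons inE wl orbT.
    * exact: wc.
    * by rewrite e6.
    * by rewrite !e5.
    move=> y; rewrite tE mem_rcons inE => /predU1P[->|yl] yc; rewrite !e5.
      by rewrite g5n.
    exact: Gmin.
  + by rewrite /= e5.
  + by rewrite /= e6.
  by move=> b bc /=; rewrite e5 e6; apply: oth.
move=> t st' [tT [S eqn g5 g6 oth]]; split=> //.
- by lia.
- by same_tac.
by move: eqn; rewrite take_size.
Qed.

(** * Solving all windows, layer by layer towards [s] *)

Definition optimize : cmd :=
  For 5 (Cst 0) (Op Mul (Var 0) (Var 3))
    (Seq (Assign 6 (Op Mod (Var 5) (Var 3)))
    (Seq (Assign 7 (Op Mod (Var 6) (Var 0)))
         (If (Op Eq (Op Add (Get 2 (Op Add (Op Mul (Var 2) (Var 0)) (Var 7)))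
                            (Op Add (Op Div (Var 5) (Var 3)) (Cst 1)))
                    (Var 0))
             (Seq window_dists (Seq descend choose_child))
             Skip))).

(* The step at which [optimize] treats the window [c]. *)
Definition rank (c : nat) : nat := (n - (distn s (c %% n)).+1) * M + c.

Definition solved (st : state) (c : nat) : Prop :=
  [/\ forall x, x < n -> arr st 4 (c * n + x) = dist_descn (c %% n) x,
      dp_eqn (nbrs (c %% n)) (arr st 5) (arr st 6) c & arr st 5 c < n].

Lemma rank_lt c : c < M -> rank c < n * M.
Proof.
move=> cM; rewrite /rank; apply: pair_lt cM.
by have := distn_lt s graph_e s (c %% n); lia.
Qed.

Lemma rankE c i : c < M -> (rank c == i) =
  (c == i %% M) && (distn s (c %% n) + (i %/ M + 1) == n).
Proof.
move=> cM; have dn := distn_lt s graph_e s (c %% n); have := M_gt0 => Mg.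
apply/eqP/andP => [<-|[/eqP cE /eqP lE]].
  by rewrite /rank modnMDl modn_small // divnMDl // divn_small // eqxx; split=> //; lia.
by rewrite /rank {2}cE [RHS](divn_eq i M); congr (_ * _ + _); lia.
Qed.

(** A child is one layer farther from [s], and farther layers come first. *)
Lemma rank_next c v : c < M -> v < n -> childn (c %% n) v -> rank (next c v) < rank c.
Proof.
move=> cM vn /eqP dv; rewrite /rank shift_in_mod // dv.
have := shift_in_lt gamma c v n_gt0; have := distn_lt s graph_e s v; rewrite dv.
move: (distn _ _) => d dn nM.
have -> : n - d.+1 = (n - d.+2).+1 by lia.
by rewrite mulSn; lia.
Qed.

(** Per neighbour, [descend] and [choose_child] take [130 * n + 160], at most [290 * n]. *)
Definition solve_cost (u : nat) : nat := n * (50 * gamma.+1 + 170) + deg u * (290 * n).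

Lemma wp_optimize st : env_dp st ->
  wp W optimize st (fun t st' => [/\ t <= n * M * (50 * gamma + 300) + 290 * (M * offset n) + 20,
    same [:: 5; 6; 7; 8; 9; 10; 11; 12; 13; 14] [:: 4; 5; 6; 7] st st' &
    forall c, c < M -> solved st' c]).
Proof.
move=> D; have E := env_dp_env D; have MnM := M_le_nM; have nM := n_le_M.
have := M_gt0 => Mg.
(* The counter runs over all pairs of a layer and a code. Only the matching layer does real work, so
   the windows need no sorting, at the price of [n * M] tests. *)
pose f i := 50 + (if distn s (i %% M %% n) + (i %/ M + 1) == n
                  then solve_cost (i %% M %% n) else 0).
apply: wp_conseq (wp_for (a := 0) (b := n * M) (f := f) (I := fun i st' =>
   same [:: 5; 6; 7; 8; 9; 10; 11; 12; 13; 14] [:: 4; 5; 6; 7] st st' /\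
   forall c, c < M -> rank c < i -> solved st' c) _ _ _ _ _ _ _ _) _; try lia.
- by move=> /=; lia.
- by [].
- by split=> //; same_tac.
- move=> i st' _ _ [S _]; rewrite /=; read_state; rewrite (env_n E) (env_dp_M D).
  by repeat split; lia.
- move=> i st1 /andP[_ inM] xi [S sol].
  have cM : i %% M < M by rewrite ltn_mod.
  have cm := ltn_pmod (i %% M) n_gt0; set c := i %% M in cM cm.
  have sn := ltn_ord s; have p1 := pair_lt sn cm.
  have dn := distn_lt s graph_e s (c %% n).
  have iM : i %/ M < n by rewrite ltn_divLR.
  apply: wp_seq; apply: wp_assign; rewrite /= xi; read_state; rewrite (env_dp_M D) -/c.
    by repeat split; lia.
  apply: wp_seq; apply: wp_assign; rewrite /=; read_state; rewrite (env_n E).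
    by repeat split; lia.
  set st2 := set_reg _ _ _.
  have S2 : same [:: 5; 6; 7; 8; 9; 10; 11; 12; 13; 14] [:: 4; 5; 6; 7] st st2.
    by rewrite /st2; same_tac.
  have D2 : env_dp st2 by apply: (env_dp_same D S2).
  have r52 : reg st2 5 = i by rewrite /= xi.
  have r02 := env_n (env_dp_env D2); have rs2 := env_s (env_dp_env D2).
  have rM2 := env_dp_M D2; have d2 := env_dp_dist D2 sn cm.
  have fE : f i = 50 + (if distn s (c %% n) + (i %/ M + 1) == n
                        then solve_cost (c %% n) else 0) by [].
  have r72 : reg st2 7 = c %% n by [].
  have testE : [/\ fits W st2 (Op Eq (Op Add (Get 2 (Op Add (Op Mul (Var 2) (Var 0)) (Var 7)))
                            (Op Add (Op Div (Var 5) (Var 3)) (Cst 1))) (Var 0)) &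
     den st2 (Op Eq (Op Add (Get 2 (Op Add (Op Mul (Var 2) (Var 0)) (Var 7)))
                            (Op Add (Op Div (Var 5) (Var 3)) (Cst 1))) (Var 0))
       = (distn s (c %% n) + (i %/ M + 1) == n)].
    cbn [fits den binop_sem]; rewrite r52 r02 rs2 rM2 r72 d2; split=> //.
    by repeat split; try lia; case: (_ == _); lia.
  have cost_test : cost (Op Eq (Op Add (Get 2 (Op Add (Op Mul (Var 2) (Var 0)) (Var 7)))
                            (Op Add (Op Div (Var 5) (Var 3)) (Cst 1))) (Var 0)) = 14 by [].
  case: testE; move: (Op Eq _ _) cost_test => test cost_test ft dt.
  apply: wp_if; rewrite ?dt //; last first.
    move=> nl; apply: wp_skip; rewrite fE cost_test; case: eqP nl => // nl _.
    split; [by lia|by rewrite /= xi|split; first by same_tac].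
    move=> b bM; rewrite ltnS leq_eqVlt rankE // => /orP[/andP[/eqP bc /eqP]|]; last exact: sol.
    by rewrite bc.
  rewrite eqb0 negbK => layer; rewrite layer in fE.
  have rc : rank c = i by apply/eqP; rewrite rankE // eqxx layer.
  have oldrank b : b < M -> rank b < i -> b != c.
    by move=> bM bi; apply/eqP => bc; move: bi; rewrite bc rc ltnn.
  have childs v : v \in nbrs (c %% n) -> childn (c %% n) v ->
      next c v != c /\ solved st1 (next c v).
    move=> vu uv; have vn := nbrs_lt vu; have rn := rank_next cM vn uv.
    rewrite rc in rn; have nM' := shift_in_lt gamma c v n_gt0.
    by split; [apply: oldrank|apply: sol].
  apply: wp_seq; apply: wp_conseq (wp_window_dists D2 cM (erefl c : reg st2 6 = c) r72) _.
  move=> t3 st3 [tT3 S3 a7 a4 a4'].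
  have D3 : env_dp st3 by apply: (env_dp_same D2 S3).
  have r63 : reg st3 6 = c by read_state.
  have r73 : reg st3 7 = c %% n by read_state.
  apply: wp_seq; apply: wp_conseq (wp_descend D3 cM r63 r73 a4 _) _.
    move=> v x vu uv xn; have [nc [d4 _ _]] := childs v vu uv; split=> //.
    by rewrite a4' // d4 // shift_in_mod // (nbrs_lt vu).
  move=> t4 st4 [tT4 S4 b4 b4'].
  have D4 : env_dp st4 by apply: (env_dp_same D3 S4).
  have r64 : reg st4 6 = c by read_state.
  have r74 : reg st4 7 = c %% n by read_state.
  apply: wp_conseq (wp_choose_child D4 cM r64 r74 _ b4 _) _.
    by move=> x xn; read_state; apply: a7.
  - move=> v vu uv; have [nc [d4 _ g5]] := childs v vu uv; split=> //; first by read_state.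
    by move=> x xn; rewrite b4' // a4' // d4 // shift_in_mod // (nbrs_lt vu).
  move=> t5 st5 [tT5 S5 eqn g5 oth].
  have d4E b x : b != c -> x < n -> arr st5 4 (b * n + x) = arr st1 4 (b * n + x).
    by move=> bc xn; rewrite (same_arr _ S5) // b4' // a4'.
  have g5E b : b != c -> arr st5 5 b = arr st1 5 b.
    by move=> bc; have [-> _] := oth b bc; read_state.
  have g6E b : b != c -> arr st5 6 b = arr st1 6 b.
    by move=> bc; have [_ ->] := oth b bc; read_state.
  split; [|by read_state|split; first by same_tac].
    by rewrite fE cost_test /solve_cost; move: tT3 tT4 tT5; rewrite !mulnDr; nia.
  move=> b bM; rewrite ltnS leq_eqVlt rankE //.
  case: (eqVneq b c) => [-> _|bc /= bi].
    split=> //; first by move=> x xn /=; rewrite (same_arr _ S5) // b4.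
  have [d4 eqb gb] := sol b bM bi.
  split=> /=; [by move=> x xn; rewrite d4E // d4| |by rewrite g5E].
  (* Writing the entries of [c] leaves the equation of an older window [b] intact: the successors of
     [b] have still smaller rank and so differ from [c]. *)
  have nb v : v \in nbrs (b %% n) -> childn (b %% n) v ->
      arr st5 5 (next b v) = arr st1 5 (next b v).
    move=> vu uv; rewrite g5E //; apply: oldrank; first exact: shift_in_lt.
    by apply: ltn_trans bi; apply: rank_next => //; apply: nbrs_lt vu.
  case: eqb => [[nx0 G0 l0]|[w [wl wc nxE GE Gmin]]]; [left|right].
    by rewrite g5E // g6E.
  exists w; rewrite g5E // g6E // nb //; split=> // y yl yc.
  by rewrite nb //; apply: Gmin.
move=> t st' [tT [S sol]]; split=> //; last by move=> c cM; apply: sol => //; apply: rank_lt.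
apply: leq_trans tT _.
have -> : cost (Op Mul (Var 0) (Var 3)) = 3 by [].
have -> : cost (Cst 0) = 1 by [].
rewrite [X in X + _](sum_divn_modn n (fun a c => 50 + (if distn s (c %% n) + (a + 1) == n
   then solve_cost (c %% n) else 0) + 10) Mg).
(* For each code exactly one layer passes the test, so its solving cost is counted once. *)
have split_sum : \sum_(0 <= a < n) \sum_(0 <= c < M) (50 +
    (if distn s (c %% n) + (a + 1) == n then solve_cost (c %% n) else 0) + 10)
  <= n * M * 60 + \sum_(0 <= c < M) solve_cost (c %% n).
  rewrite exchange_big_nat /=.
  have -> : n * M * 60 = \sum_(0 <= c < M) 60 * n.
    by rewrite sum_nat_const_nat subn0; lia.
  rewrite -big_split /=; apply: leq_sum => c _.
  rewrite (eq_bigr (fun a => 60 + (if distn s (c %% n) + (a + 1) == n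
             then solve_cost (c %% n) else 0))); last by move=> a _; lia.
  rewrite big_split /= sum_nat_const_nat subn0 mulnC leq_add2l.
  have dn := distn_lt s graph_e s (c %% n).
  rewrite -big_mkcond (eq_bigl (fun a => a == n - (distn s (c %% n)).+1)) /=; last first.
    by move=> a; apply/eqP/eqP; lia.
  by rewrite big_nat1_eq; case: ifP.
(* Each vertex is the last one of [n ^ gamma] codes; summing its degree over them yields the factor
   [offset n]. *)
have sum_solve : \sum_(0 <= c < M) solve_cost (c %% n) =
    n ^ gamma * (n * (n * (50 * gamma.+1 + 170)) + offset n * (290 * n)).
  rewrite expnSr (sum_divn_modn (n ^ gamma) (fun _ u => solve_cost u) n_gt0).
  rewrite sum_nat_const_nat subn0 /solve_cost big_split /= sum_nat_const_nat subn0.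
  by rewrite -big_distrl.
apply: leq_trans (leq_add split_sum (leqnn _)) _; rewrite sum_solve.
have -> : M = n ^ gamma * n by rewrite expnSr.
by move: (n ^ gamma) => g; nia.
Qed.

(** * Reading off an optimal path *)

Definition emit : cmd :=
  Seq (Assign 5 (Var 4))
 (Seq (Put 0 (Cst 0) (Var 2))
 (Seq (Assign 6 (Cst 1))
 (Seq (While (Get 6 (Var 5))
        (Seq (Assign 7 (Op Defs.Sub (Get 6 (Var 5)) (Cst 1)))
        (Seq (Put 0 (Var 6) (Var 7))
        (Seq (Assign 6 (Op Add (Var 6) (Cst 1)))
             (Assign 5 (Op Mod (Op Add (Op Mul (Var 5) (Var 0)) (Var 7)) (Var 3)))))))
      (Assign 0 (Var 6))))).

Local Notation code := (code gamma s).

Lemma wp_emit G st : env_dp st ->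
  (forall c, c < M -> dp_eqn (nbrs (c %% n)) G (arr st 6) c) ->
  wp W emit st (fun t st' => t <= 40 * n + 50 /\
    exists p : seq 'I_n, [/\ output st' = [seq val w | w <- s :: p],
      dp_path e gamma s G p & arr st 6 (code p) = 0]).
Proof.
move=> D dp; have E := env_dp_env D; have MnM := M_le_nM; have nM := n_le_M.
have nx_le c : c < M -> arr st 6 c <= n.
  by move=> cM; case: (dp c cM) => [[->]|[v [vn _ -> _ _]]] //; apply: nbrs_lt vn.
have sn := ltn_ord s.
have cs : repdigit n s gamma.+1 < M by apply: repdigit_lt.
apply: wp_seq; apply: wp_assign; rewrite /= (env_dp_start D); first by lia.
(* The output overwrites the offsets in array 0, which are no longer read; register 0 keeps [n]
   until the loop is over. *)
apply: wp_seq; apply: wp_put; rewrite /= ?(env_s E); try lia.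
apply: wp_seq; apply: wp_assign; rewrite /=; first by lia.
set st1 := set_reg _ 6 1.
have S1 : same [:: 5; 6] [:: 0] st st1 by rewrite /st1; same_tac.
pose I B st' := exists p : seq 'I_n, [/\ same [:: 5; 6; 7] [:: 0] st st',
  dp_path e gamma s G p, reg st' 5 = code p /\ reg st' 6 = (size p).+1,
  forall i, i <= size p -> arr st' 0 i = nth 0 [seq val w | w <- s :: p] i &
  B = (n - size p) * 40 + 10].
pose Q st' := exists p : seq 'I_n, [/\ dp_path e gamma s G p,
  reg st' 6 = (size p).+1,
  forall i, i <= size p -> arr st' 0 i = nth 0 [seq val w | w <- s :: p] i,
  arr st 6 (code p) = 0 & size p < n].
(* The length of a shortest path is a distance. This bounds the number of rounds, although the loop
   tests no counter. *)
have size_lt p : dp_path e gamma s G p -> size p < n.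
  by case=> /andP[_ /eqP <-] _; rewrite -[ltnRHS]card_ord; apply: dist_ltn_card.
apply: wp_seq; apply: wp_conseq (wp_while (I := I) (Q := Q) _ (B := n * 40 + 10) (st := st1) _) _.
- move=> B st2 [p [S dpp [r5 r6] a0 BE]].
  have cM := code_lt gamma s p; have sp := size_lt p dpp.
  have a6 : arr st2 6 (code p) = arr st 6 (code p) by read_state.
  have nxc := nx_le _ cM.
  rewrite /= r5 a6; split; first by split; lia.
  case: eqP => [nx0|/eqP nx0]; first by split; [lia|exists p].
  have [vn dpv] := dp_path_step adjP dp dpp nx0.
  have sp1 := size_lt _ dpv; rewrite size_rcons in sp1.
  set v := (arr st 6 (code p)).-1 in vn dpv.
  have p1 := pair_lt cM vn; rewrite [M * n]mulnC in p1.
  have nextE : (code p * n + v) %% M = code (rcons p (vtx s v)).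
    by rewrite code_rcons vtxK.
  apply: wp_seq; apply: wp_assign; rewrite /= r5 a6 subn1 -/v; first by repeat split; lia.
  apply: wp_seq; apply: wp_put; rewrite /= ?r6; try lia.
  apply: wp_seq; apply: wp_assign; rewrite /= r6 addn1; first by repeat split; lia.
  apply: wp_assign; rewrite /= r5; read_state; rewrite (env_n E) (env_dp_M D) nextE.
    by have := code_lt gamma s (rcons p (vtx s v)); repeat split; lia.
  exists ((n - (size p).+1) * 40 + 10); last by lia.
  exists (rcons p (vtx s v)); rewrite size_rcons; split=> //; first by same_tac.
  move=> i; rewrite leq_eqVlt /= => /predU1P[->|ip].
    by rewrite eqxx /= map_rcons nth_rcons size_map ltnn eqxx vtxK.
  rewrite (ltn_eqF ip) /=.
  by rewrite a0 // map_rcons -rcons_cons nth_rcons /= size_map ip.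
- exists [::]; split=> //; try (by rewrite subn0); first by same_tac.
    exact: dp_path_nil.
  by move=> i; rewrite leqn0 => /eqP ->.
move=> t st2 [tB [p [dpp r6 a0 nx0 sp]]].
apply: wp_assign; rewrite /= r6; first by lia.
split; first by lia.
exists p; split=> //; rewrite /output /=.
apply: (@eq_from_nth _ 0); rewrite size_mkseq /= ?size_map // => i ip.
by rewrite nth_mkseq // a0.
Qed.

Definition mesp : cmd := Seq all_pairs (Seq powers (Seq optimize emit)).

Lemma wp_mesp st :
  pg_at_most e gamma -> env st -> reg st 4 = 0 ->
  (forall p, p < n * n -> arr st 2 p = 0) ->
  wp W mesp st (fun t st' =>
    t <= 100 * (n * n + n * offset n) + 40 * gamma + 40 * n +
         n * M * (50 * gamma + 300) + 290 * (M * offset n) + 230 /\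
    exists p : seq 'I_n, [/\ output st' = [seq val w | w <- s :: p],
      shortest_path e s p &
      forall q : seq 'I_n, shortest_path e s q ->
        ecc e [set w in s :: p] <= ecc e [set w in s :: q]]).
Proof.
move=> pg E r4 a2.
apply: wp_seq; apply: wp_conseq (wp_all_pairs E a2) _ => t1 st1 [tT1 S1 d1].
have E1 : env st1 by apply: (env_same E S1).
have r41 : reg st1 4 = 0 by read_state.
apply: wp_seq; apply: wp_conseq (wp_powers E1 r41) _ => t2 st2 [tT2 S2 rM rs].
have D2 : env_dp st2.
  split=> //; first by apply: (env_same E1 S2).
  by move=> u v un vn; read_state; apply: d1.
apply: wp_seq; apply: wp_conseq (wp_optimize D2) _ => t3 st3 [tT3 S3 sol].
have D3 : env_dp st3 by apply: (env_dp_same D2 S3).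
have dp c : c < M -> dp_eqn (nbrs (c %% n)) (arr st3 5) (arr st3 6) c.
  by case/sol.
apply: wp_conseq (wp_emit D3 dp) _ => t4 st4 [tT4 [p [outE dpp nx0]]].
split; first by lia.
exists p; split=> //; first by case: dpp.
by move=> q; apply: (dp_path_optimal graph_e adjP pg dp dpp nx0).
Qed.

End Program.

(** * Degree sums, edges and the layout of the input *)

Section Degrees.
Variables (n : nat) (e : rel 'I_n) (adj : 'I_n -> seq 'I_n) (s : 'I_n).
Hypotheses (graph_e : connected_simple_graph e) (adjP : adjacency_lists e adj).

Lemma offset_sum : offset adj s n = \sum_(u : 'I_n) size (adj u).
Proof.
rewrite /offset big_mkord; apply: eq_bigr => u _.
by rewrite size_map vtx_val.
Qed.

(** A connected graph with at least two vertices has no isolated vertex. This absorbs the terms of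
    the running time that lack a factor [m]. *)
Lemma leq_offset : 1 < n -> n <= offset adj s n.
Proof.
move=> n1; rewrite offset_sum -{1}[n]card_ord -sum1_card; apply: leq_sum => u _.
have [w wu] : exists w : 'I_n, w != u.
  case: (eqVneq u (Ordinal n1)) => [->|un]; first by exists (Ordinal (ltnW n1)).
  by exists (Ordinal n1); rewrite eq_sym.
case dk : (dist e u w) => [|k]; first by rewrite (dist_eq0 graph_e dk) eqxx in wu.
have [z euz _] := dist_succ graph_e dk; have [_ az] := adjP u.
have : z \in adj u by rewrite az.
by case: (adj u).
Qed.

(** Double counting: degrees count ordered adjacent pairs, and at most two of these have the same
    edge as image. *)
Lemma offset_edges : offset adj s n <= 2 * #|edges e|.
Proof.
pose A : {set 'I_n * 'I_n} := [set xy | e xy.1 xy.2].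
pose f (xy : 'I_n * 'I_n) : {set 'I_n} := [set xy.1; xy.2].
have -> : offset adj s n = #|A|.
  rewrite offset_sum -sum1_card (partition_big fst xpredT) //=.
  apply: eq_bigr => u _; have [Uu ue] := adjP u.
  have Up : uniq (map (pair u) (adj u)) by rewrite map_inj_uniq // => a b [].
  rewrite sum1_card -(size_map (pair u)) -(card_uniqP Up); apply: eq_card => -[a b].
  apply/mapP/andP => [[v + [-> ->]]|[]].
    by rewrite ue inE.
  rewrite inE /= => eab /eqP au; rewrite -au in ue *; exists b => //.
  by rewrite ue.
have -> : edges e = f @: A.
  by apply/setP => X; apply/imsetP/imsetP => -[xy H ->]; exists xy; rewrite ?inE // in H *.
rewrite -sum1_card (partition_big_imset f) /= mulnC -sum_nat_const.
apply: leq_sum => X /imsetP[[x y] _ ->]; rewrite sum1_card.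
apply: leq_trans (_ : #|[set (x, y); (y, x)]| <= 2); last first.
  by rewrite cards2; case: (_ != _).
apply: subset_leq_card; apply/subsetP => -[a b].
rewrite !inE => /andP[eab /eqP fE]; rewrite !xpair_eqE.
have ab : a != b.
  move: eab; rewrite inE /=; case: graph_e => _ irr _; apply: contraTneq => ->.
  by rewrite irr.
have /set2P[ax|ay] : a \in [set x; y] by rewrite -[[set x; y]]/(f (x, y)) -fE; apply: set21.
  have /set2P[bx|by_] : b \in [set x; y] by rewrite -[[set x; y]]/(f (x, y)) -fE; apply: set22.
    by rewrite ax bx eqxx in ab.
  by rewrite ax by_ !eqxx.
have /set2P[bx|by_] : b \in [set x; y] by rewrite -[[set x; y]]/(f (x, y)) -fE; apply: set22.
  by rewrite ay bx !eqxx orbT.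
by rewrite ay by_ eqxx in ab.
Qed.

Lemma env_input gamma : env adj gamma s (input adj gamma s).
Proof.
pose lists := [seq adj u | u <- enum 'I_n].
have szl : size lists = n by rewrite size_map size_enum_ord.
have szsh : size (shape lists) = n by rewrite size_map szl.
have lE u : u < n -> nth [::] lists u = adj (vtx s u).
  move=> un; rewrite (nth_map s) ?size_enum_ord //; congr adj.
  by apply/val_inj; rewrite /= nth_enum_ord // vtxK.
have shE u : u < n -> nth 0 (shape lists) u = size (nbrs adj s u).
  by move=> un; rewrite (nth_map [::]) ?szl // lE // size_map.
have offE u : u <= n -> sumn (take u (shape lists)) = offset adj s u.
  elim: u => [|u IH] un; first by rewrite take0 /offset big_geq.
  rewrite (take_nth 0) ?szsh // sumn_rcons IH ?(ltnW un) //.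
  by rewrite shE // offsetS.
split=> //=.
  by move=> u un; rewrite nth_mkseq ?offE.
move=> u i un iu; rewrite map_flatten -/lists.
have shE' : shape [seq [seq val j | j <- l] | l <- lists] = shape lists.
  by rewrite /shape -map_comp; apply: eq_map => l /=; rewrite size_map.
rewrite -(offE u (ltnW un)) -/(flatten_index (shape lists) u i) nth_flatten shE'.
rewrite flatten_indexKl ?flatten_indexKr ?shE //.
by rewrite (nth_map [::]) ?szl // lE.
Qed.

End Degrees.

(** No distance exceeds [n], so a projection gap of at most [n] holds vacuously, and [gamma] is
    minimal. *)
Lemma pg_le_order (n : nat) (e : rel 'I_n) gamma :
  connected_simple_graph e -> is_pg e gamma -> gamma <= n.
Proof.
move=> graph_e [_]; apply => v0 p _ P v x i k _ _ _.
by have := dist_ltn_card graph_e (v i) (v k); rewrite card_ord; lia.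
Qed.

(** The exponent splits into [gamma + 2] for the products of powers of [n], [gamma] for the summand
    [gamma], and [8 * (gamma + 1)], worth a factor of at least 256, for the constants. *)
Lemma word_size n gamma : 0 < n ->
  n * n ^ gamma.+1 + n * n + n + gamma + 20 < n.+1 ^ (10 * gamma.+1).
Proof.
move=> n0; have -> : 10 * gamma.+1 = gamma.+2 + (gamma + (8 * gamma.+1)) by lia.
rewrite expnD expnD; set x := n.+1 ^ gamma.+2.
have x1 : n * n ^ gamma.+1 <= x by rewrite -expnS leq_exp2r.
have x2 : n.+1 * n.+1 <= x by rewrite mulnn leq_pexp2l.
have y1 : gamma < n.+1 ^ gamma.
  apply: leq_trans (ltn_expl gamma (ltnSn 1)) _.
  by case: (gamma) => [|g]; rewrite ?expn0 ?leq_exp2r ?ltnS.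
have z1 : 256 <= n.+1 ^ (8 * gamma.+1).
  apply: leq_trans (_ : 2 ^ 8 <= _) => //.
  by apply: leq_trans (_ : n.+1 ^ 8 <= _); [rewrite leq_exp2r|rewrite leq_pexp2l //; lia].
move: (n.+1 ^ gamma) (n.+1 ^ (8 * _)) y1 z1 x1 => y z y1 z1.
move: (n * _) => nM x1.
have yz : gamma.+1 * 256 <= y * z by apply: leq_mul.
have : x * (gamma.+1 * 256) <= x * (y * z) by rewrite leq_mul2l yz orbT.
by apply: leq_trans; nia.
Qed.

Theorem theorem3 :
  exists (prog : cmd) (k C N : nat),
  forall (n : nat) (e : rel 'I_n) (adj : 'I_n -> seq 'I_n)
         (gamma : nat) (s : 'I_n),
    connected_simple_graph e -> adjacency_lists e adj -> is_pg e gamma ->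
    let m := #|edges e| in
    exists (t : nat) (final : state) (p : seq 'I_n),
      [/\ exec (n.+1 ^ (k * gamma.+1)) prog (input adj gamma s) t final,
          output final = [seq val w | w <- s :: p],
          shortest_path e s p,
          (forall q : seq 'I_n, shortest_path e s q ->
             ecc e [set w in s :: p] <= ecc e [set w in s :: q])
        & N <= n ->
          [/\ 2 <= gamma -> t <= C * n ^ (gamma + 3),
              gamma = 1 -> t <= C * (n ^ 2 * m)
            & gamma = 0 -> t <= C * (n * m)]].
Proof.
(* The threshold is 2 because a single vertex has [m = 0], which would make the bounds with a factor
   [m] vanish. *)
exists mesp, 10, 2000, 2 => n e adj gamma s graph_e adjP pg m.
have gn := pg_le_order graph_e pg; have [pg_gamma _] := pg.
have HW := word_size gamma (order_gt0 s).
have [||t [st [ex [tT [p [outE sp opt]]]]]] :=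
  wp_mesp graph_e adjP HW pg_gamma (env_input adj s gamma) => //.
  by move=> i _; rewrite /= nth_nil.
exists t, st, p; split=> // n2.
have o1 := leq_offset s graph_e adjP n2.
have o2 := offset_edges s graph_e adjP; rewrite -/m in o2.
have o3 := @offset_le n e adj s adjP n (leqnn n).
move: (offset _ _ _) => o in tT o1 o2 o3.
split=> [g2|g1|g0].
(* Here the degree sum is bounded by [n * n], and [gamma <= n] absorbs the factor [gamma] of the
   window length into one more power of [n]. *)
- rewrite addn3 !expnS; rewrite expnS in tT.
  have g1 : n <= n ^ gamma by rewrite -{1}(expn1 n) leq_pexp2l //; lia.
  move: (n ^ gamma) => x in tT g1 *; nia.
- rewrite g1 in tT *; nia.
rewrite g0 in tT *; nia.
Qed.
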